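(* Let $M$ and $E$ be persistence modules. A morphism $g \colon M \to E$ is the injective hull (of $M$) if and only if $g^\vee \colon E^\vee \to M^\vee$ is the flat cover (of $M^\vee$). Further, let $F$ be a pointwise finite-dimensional persistence module with a morphism $f \colon F \to M$. Then $f$ is the flat cover (of $M$) if and only if $f^\vee \colon M^\vee \to F^\vee$ is the injective hull (of $M^\vee$).
   Context: Fix $n \in \mathbb{N}$, a field $\mathbf{k}$, and the polynomial ring $R = \mathbf{k}[x_1,\dots,x_n]$, $\mathbb{Z}^n$-graded by $\deg x_i = \mathbf{e}_i$ (standard basis vector). A persistence module is a $\mathbb{Z}^n$-graded $R$-module $M=\bigoplus_{\mathbf a\in\mathbb Z^n} M_{\mathbf a}$; a morphism is a degree-preserving $R$-linear map, and $\operatorname{Nat}(M,N)$ is the set of morphisms. The shift is $M(\mathbf{a})_{\mathbf{d}} = M_{\mathbf{a}+\mathbf{d}}$. The graded Hom is $\underline{\operatorname{Hom}}(M,N) = \bigoplus_{\mathbf{a}\in\mathbb{Z}^n} \operatorname{Nat}(M,N(\mathbf{a}))$. $M$ is pointwise finite-dimensional if $\dim_{\mathbf{k}} M_{\mathbf{a}}<\infty$ for all $\mathbf{a}$. A persistence module $F$ is flat if $F\otimes_R -$ is exact on persistence modules, and $E$ is injective if $\underline{\operatorname{Hom}}(-,E)$ is exact on persistence modules (i.e. injective in the graded category). A monomorphism $M\to E$ is an injective hull if $E$ is injective and every nonzero (graded) submodule of $E$ meets the image of $M$ nontrivially; $E(M)$ denotes the injective hull of $M$. A morphism $f\colon F\to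 M$ with $F$ flat is a flat precover if every morphism $F'\to M$ with $F'$ flat factors through $f$; it is a flat cover if moreover every morphism $h\colon F\to F$ with $fh=f$ is an isomorphism. Injective hulls and flat covers exist and are unique up to isomorphism. The Matlis dual is the contravariant functor $M^\vee = \underline{\operatorname{Hom}}(M,E(\mathbf{k}))$, where $\mathbf{k}=R/\langle x_1,\dots,x_n\rangle$; it is isomorphic to $M\mapsto\bigoplus_{\mathbf{a}\in\mathbb{Z}^n} \operatorname{Hom}_{\mathbf{k}}(M_{-\mathbf{a}},\mathbf{k})$. *)

(* Defs.v *)
From HB Require Import structures.
From mathcomp Require Import all_boot all_order all_algebra.
From mathcomp Require Import mpoly freeg.
From mathcomp Require Import boolp classical_sets functions.

Set Implicit Arguments.
Unset Strict Implicit.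
Unset Printing Implicit Defensive.

Import GRing.Theory.
Local Open Scope quotient_scope.
Local Open Scope ring_scope.

Section TensorModule.
Context (R : comNzRingType) (M N : lmodType R).

(* The relations of [M (x)_R N] on the free abelian group on [M * N]. *)
Inductive tensor_rel : {freeg (M * N)} -> Prop :=
| tensor_rel0 : tensor_rel 0
| tensor_relB u v : tensor_rel u -> tensor_rel v -> tensor_rel (u - v)
| tensor_rel_addl x x' y :
    tensor_rel (<< (x + x', y) >> - << (x, y) >> - << (x', y) >>)
| tensor_rel_addr x y y' :
    tensor_rel (<< (x, y + y') >> - << (x, y) >> - << (x, y') >>)
| tensor_rel_bal r x y :
    tensor_rel (<< (r *: x, y) >> - << (x, r *: y) >>).

Definition tensor_pred : {pred {freeg (M * N)}} := fun u => `[< tensor_rel u >].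

Lemma tensor_zmod_closed : zmod_closed tensor_pred.
Proof.
split; first by apply/asboolP; apply: tensor_rel0.
by move=> u v /asboolP hu /asboolP hv; apply/asboolP; apply: tensor_relB.
Qed.

HB.instance Definition _ :=
  GRing.isZmodClosed.Build {freeg (M * N)} tensor_pred tensor_zmod_closed.

Definition tensor : Type := Quotient.quot tensor_pred.
HB.instance Definition _ := GRing.Zmodule.on tensor.

Definition tens (x : M) (y : N) : tensor := \pi_(Quotient.quot tensor_pred) << (x, y) >>.

Lemma tensor_piB (u v : {freeg (M * N)}) :
  (\pi_(Quotient.quot tensor_pred) (u - v) : tensor) =
  \pi_(Quotient.quot tensor_pred) u - \pi_(Quotient.quot tensor_pred) v.
Proof. exact: raddfB. Qed.

Lemma tensor_pi0 (u : {freeg (M * N)}) :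
  tensor_rel u -> (\pi_(Quotient.quot tensor_pred) u : tensor) = 0.
Proof.
move=> hu; rewrite -[RHS](raddf0 \pi_(Quotient.quot tensor_pred)).
by apply/eqP; rewrite -Quotient.idealrBE subr0; apply/asboolP.
Qed.

Lemma tensDl x x' y : tens (x + x') y = tens x y + tens x' y.
Proof.
apply/eqP; rewrite -subr_eq0 opprD addrA -!tensor_piB.
by apply/eqP/tensor_pi0; apply: tensor_rel_addl.
Qed.

Lemma tensDr x y y' : tens x (y + y') = tens x y + tens x y'.
Proof.
apply/eqP; rewrite -subr_eq0 opprD addrA -!tensor_piB.
by apply/eqP/tensor_pi0; apply: tensor_rel_addr.
Qed.

Lemma tens_bal r x y : tens (r *: x) y = tens x (r *: y).
Proof.
apply/eqP; rewrite -subr_eq0 -tensor_piB.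
by apply/eqP/tensor_pi0; apply: tensor_rel_bal.
Qed.

Lemma tensor_ind (P : tensor -> Prop) :
  P 0 -> (forall t t', P t -> P t' -> P (t - t')) ->
  (forall x y, P (tens x y)) -> forall t, P t.
Proof.
move=> P0 PB PT t.
have PD t1 t2 : P t1 -> P t2 -> P (t1 + t2).
  by move=> h1 h2; rewrite -[t2]opprK; apply: (PB) => //; rewrite -sub0r; apply: (PB).
have PMn t1 i : P t1 -> P (t1 *+ i).
  by move=> h1; elim: i => [//|i IH]; rewrite mulrS; apply: PD.
rewrite -[t]reprK -[repr t]freeg_sumE raddf_sum.
elim: (dom _) => [|[x y] s IH]; first by rewrite big_nil.
rewrite big_cons; apply: PD => //.
have h c : P (\pi_(Quotient.quot tensor_pred) (<< c%:Z *g (x, y) >>)).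
  have := PMn _ c (PT x y).
  by rewrite -raddfMn freeg_muln -mulr_natl mulr1 natz.
case: (coeff (x, y) (repr t)) => c; first exact: h.
by rewrite NegzE -freegUN raddfN -sub0r; apply: PB => //; apply: h.
Qed.

Section Lift.
Context (V : zmodType) (b : M -> N -> V).
Hypothesis bDl : forall x x' y, b (x + x') y = b x y + b x' y.
Hypothesis bDr : forall x y y', b x (y + y') = b x y + b x y'.
Hypothesis bbal : forall r x y, b (r *: x) y = b x (r *: y).

Let bl (u : {freeg (M * N)}) : zmodule V :=
  fglift (fun z : M * N => b z.1 z.2 : zmodule V) u.

Definition tensor_lift (t : tensor) : V :=
  bl (repr (t : Quotient.quot tensor_pred)).

Let blB u v : bl (u - v) = bl u - bl v.
Proof. exact: (@lift_is_additive int _ (zmodule V)). Qed.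

Let blU z : bl << z >> = b z.1 z.2.
Proof. by rewrite /bl liftU scale1r. Qed.

Let bl_rel u : tensor_rel u -> bl u = 0.
Proof.
elim=> [|u' v _ hu _ hv|x x' y|x y y'|r x y].
- by rewrite -(subrr 0) blB subrr.
- by rewrite blB hu hv subrr.
- by rewrite !blB !blU /= bDl -addrA -opprD subrr.
- by rewrite !blB !blU /= bDr -addrA -opprD subrr.
- by rewrite !blB !blU /= bbal subrr.
Qed.

Let lift_pi u : tensor_lift (\pi_(Quotient.quot tensor_pred) u) = bl u.
Proof.
apply/eqP; rewrite -subr_eq0 -blB; apply/eqP/bl_rel/asboolP.
by have := reprK (\pi_(Quotient.quot tensor_pred) u) => /eqP; rewrite -Quotient.idealrBE.
Qed.

Lemma tensor_liftB t t' : tensor_lift (t - t') = tensor_lift t - tensor_lift t'.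
Proof.
by rewrite -[t]reprK -[t']reprK -tensor_piB !lift_pi blB.
Qed.

Lemma tensor_lift_tens x y : tensor_lift (tens x y) = b x y.
Proof. by rewrite lift_pi blU. Qed.

End Lift.
End TensorModule.

Section TensorLmodule.
Context (R : comNzRingType) (M N : lmodType R).
Implicit Types (r : R) (t : tensor M N).

Let scale_tens r (x : M) (y : N) : tensor M N := tens (r *: x) y.

Let sDl r x x' y : scale_tens r (x + x') y = scale_tens r x y + scale_tens r x' y.
Proof. by rewrite /scale_tens scalerDr tensDl. Qed.

Let sDr r x y y' : scale_tens r x (y + y') = scale_tens r x y + scale_tens r x y'.
Proof. by rewrite /scale_tens tensDr. Qed.

Let sbal r r' x y : scale_tens r (r' *: x) y = scale_tens r x (r' *: y).
Proof. by rewrite /scale_tens -tens_bal !scalerA mulrC. Qed.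

Definition tensor_scale r t := tensor_lift (scale_tens r) t.

Let scaleB r : {morph tensor_scale r : t t' / t - t'}.
Proof. exact: (tensor_liftB (sDl r) (sDr r) (sbal r)). Qed.

Let scale0 r : tensor_scale r 0 = 0.
Proof. by rewrite -(subrr 0) scaleB !subrr. Qed.

Let scaleE r x y : tensor_scale r (tens x y) = tens (r *: x) y.
Proof. exact: (tensor_lift_tens (sDl r) (sDr r) (sbal r)). Qed.

Fact tensor_scaleA r r' t :
  tensor_scale r (tensor_scale r' t) = tensor_scale (r * r') t.
Proof.
elim/tensor_ind: t => [|t t' IH IH'|x y].
- by rewrite !scale0.
- by rewrite !scaleB IH IH'.
- by rewrite !scaleE scalerA.
Qed.

Fact tensor_scale1 : left_id 1 tensor_scale.
Proof.
elim/tensor_ind=> [|t t' IH IH'|x y].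
- by rewrite scale0.
- by rewrite scaleB IH IH'.
- by rewrite scaleE scale1r.
Qed.

Fact tensor_scaleDr : right_distributive tensor_scale +%R.
Proof.
move=> r t t'; rewrite -[t' in LHS]opprK scaleB -[- t']sub0r scaleB scale0.
by rewrite sub0r opprK.
Qed.

Fact tensor_scaleDl t : {morph tensor_scale^~ t : r r' / r + r'}.
Proof.
move=> r r'; elim/tensor_ind: t => [|t t' IH IH'|x y].
- by rewrite !scale0 addr0.
- by rewrite !scaleB IH IH' opprD addrACA.
- by rewrite !scaleE scalerDl tensDl.
Qed.

HB.instance Definition _ := GRing.Zmodule_isLmodule.Build R (tensor M N)
  tensor_scaleA tensor_scale1 tensor_scaleDr tensor_scaleDl.

Lemma scaler_tens r x y : r *: tens x y = tens (r *: x) y.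
Proof. exact: scaleE. Qed.

End TensorLmodule.

Section TensorMap.
Context (R : comNzRingType) (M A B : lmodType R) (f : {linear A -> B}).

Let map_tens (x : M) (y : A) : tensor M B := tens x (f y).

Let mDl x x' y : map_tens (x + x') y = map_tens x y + map_tens x' y.
Proof. by rewrite /map_tens tensDl. Qed.

Let mDr x y y' : map_tens x (y + y') = map_tens x y + map_tens x y'.
Proof. by rewrite /map_tens linearD tensDr. Qed.

Let mbal r x y : map_tens (r *: x) y = map_tens x (r *: y).
Proof. by rewrite /map_tens tens_bal linearZ. Qed.

(* [id_M (x) f] *)
Definition tensor_map : tensor M A -> tensor M B := tensor_lift map_tens.

Lemma tensor_mapE x y : tensor_map (tens x y) = tens x (f y).
Proof. exact: (tensor_lift_tens mDl mDr mbal). Qed.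

Fact tensor_map_linear : linear tensor_map.
Proof.
have mB t t' : tensor_map (t - t') = tensor_map t - tensor_map t'.
  exact: (tensor_liftB mDl mDr mbal).
have m0 : tensor_map 0 = 0 by rewrite -(subrr 0) mB !subrr.
have mD t t' : tensor_map (t + t') = tensor_map t + tensor_map t'.
  by rewrite -[t' in LHS]opprK mB -[- t']sub0r mB m0 sub0r opprK.
move=> r t t'; rewrite mD; congr (_ + _).
elim/tensor_ind: t => [|t1 t2 IH IH'|x y].
- by rewrite scaler0 m0 scaler0.
- by rewrite scalerBr !mB IH IH' scalerBr.
- by rewrite scaler_tens !tensor_mapE scaler_tens.
Qed.

HB.instance Definition _ :=
  GRing.isLinear.Build R (tensor M A) (tensor M B) _ tensor_map tensor_map_linear.

End TensorMap.

Section PersistenceModules.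
Context (n : nat) (k : fieldType).
Local Notation R := {mpoly k[n]}.
Local Notation deg := 'rV[int]_n.

Definition mdegZ (m : 'X_{1..n}) : deg := \row_i (m i)%:Z.

Lemma mdegZ0 : mdegZ 0%MM = 0.
Proof. by apply/rowP=> i; rewrite !mxE mnm0E. Qed.

(* A [Z^n]-graded [R]-module: [hcomp a] is the homogeneous component of
   degree [a], a subgroup of the carrier; [hcomp_gen] and [hcomp_free] say
   that the carrier is the direct sum of these components, and [hcomp_act]
   that the degree-[u] part [k x^u] of [R] maps degree [a] to [a + u]. *)
Record persmod := PersMod {
  carrier :> lmodType R;
  hcomp : deg -> carrier -> Prop;
  hcomp0 : forall a, hcomp a 0;
  hcompB : forall a x y, hcomp a x -> hcomp a y -> hcomp a (x - y);
  hcomp_gen : forall x : carrier, exists2 s : seq carrier,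
    (forall y, y \in s -> exists a, hcomp a y) & x = \sum_(y <- s) y;
  hcomp_free : forall (s : seq deg) (y : deg -> carrier), uniq s ->
    (forall a, hcomp a (y a)) -> \sum_(a <- s) y a = 0 ->
    forall a, a \in s -> y a = 0;
  hcomp_act : forall (c : k) (m : 'X_{1..n}) a x,
    hcomp a x -> hcomp (a + mdegZ m) ((c *: 'X_[m]) *: x)
}.

Lemma hcompN (M : persmod) a (x : M) : hcomp a x -> hcomp a (- x).
Proof. by move=> hx; rewrite -sub0r; apply: hcompB => //; apply: hcomp0. Qed.

Lemma hcompD (M : persmod) a (x y : M) :
  hcomp a x -> hcomp a y -> hcomp a (x + y).
Proof. by move=> hx hy; rewrite -[y]opprK; apply: hcompB => //; apply: hcompN. Qed.

Lemma hcomp_sum (M : persmod) a (I : Type) (s : seq I) (F : I -> M) :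
  (forall i, hcomp a (F i)) -> hcomp a (\sum_(i <- s) F i).
Proof.
move=> h; elim: s => [|i s IH]; first by rewrite big_nil; apply: hcomp0.
by rewrite big_cons; apply: hcompD.
Qed.

Record pmor (M N : persmod) := PMor {
  pmor_fun :> {linear M -> N};
  pmor_hcomp : forall a x, hcomp a x -> hcomp a (pmor_fun x)
}.

Section Shift.
Context (M : persmod) (a : deg).

Fact shift_gen (x : M) : exists2 s : seq M,
  (forall y, y \in s -> exists d, hcomp (a + d) y) & x = \sum_(y <- s) y.
Proof.
have [s hs ->] := hcomp_gen x; exists s => // y /hs[b hb].
by exists (b - a); rewrite addrC subrK.
Qed.

Fact shift_free (s : seq deg) (y : deg -> M) : uniq s ->
  (forall d, hcomp (a + d) (y d)) -> \sum_(d <- s) y d = 0 ->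
  forall d, d \in s -> y d = 0.
Proof.
move=> us hy sum0 d ds.
have := @hcomp_free M [seq a + d | d <- s] (fun b => y (b - a)).
rewrite map_inj_uniq; last exact: addrI.
move=> /(_ us) /(_ _) h; have {h} := h _ _ (a + d).
rewrite [a + d]addrC addrK; apply.
- by move=> b; have := hy (b - a); rewrite addrC subrK.
- by rewrite big_map -[RHS]sum0; apply: eq_bigr => i _; rewrite [a + i]addrC addrK.
- by rewrite addrC map_f.
Qed.

Fact shift_act (c : k) m d (x : M) :
  hcomp (a + d) x -> hcomp (a + (d + mdegZ m)) ((c *: 'X_[m]) *: x).
Proof. by rewrite addrA; apply: hcomp_act. Qed.

Definition pm_shift : persmod :=
  @PersMod M (fun d => hcomp (a + d)) (fun d => hcomp0 M (a + d))
    (fun d => @hcompB M (a + d)) shift_gen shift_free shift_act.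

End Shift.


Lemma big_supp (I : eqType) (V : nmodType) (s t : seq I) (F : I -> V) :
  uniq s -> uniq t -> (forall i, i \notin s -> F i = 0) ->
  (forall i, i \notin t -> F i = 0) -> \sum_(i <- s) F i = \sum_(i <- t) F i.
Proof.
move=> us ut Fs Ft; rewrite (bigID (fun i => F i == 0)) /=.
rewrite [RHS](bigID (fun i => F i == 0)) /=.
rewrite !(big1 _ (fun i => F i == 0)) ?add0r; try by move=> i /eqP.
rewrite -big_filter -[RHS]big_filter; apply: perm_big; apply: uniq_perm.
- exact: filter_uniq.
- exact: filter_uniq.
move=> i; rewrite !mem_filter; case: eqP => //= Fi.
by apply/idP/idP => _; apply: contra_notT Fi; [exact: Ft | exact: Fs].
Qed.

Lemma hdecomp_ex (M : persmod) (x : M) : exists sy : seq deg * (deg -> M),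
  [/\ uniq sy.1, forall a, hcomp a (sy.2 a),
      forall a, a \notin sy.1 -> sy.2 a = 0 & x = \sum_(a <- sy.1) sy.2 a].
Proof.
have [s hs xE] := hcomp_gen x; rewrite {}xE; elim: s hs => [|z s IH] hs.
  exists ([::], fun=> 0) => /=; split => //.
    by move=> a; apply: hcomp0.
  by rewrite !big_nil.
have [|[t y] /= [ut hy y0 yE]] := IH.
  by move=> w ws; apply: hs; rewrite inE ws orbT.
have [b hb] := hs z (mem_head _ _).
pose e a := if a == b then z else 0.
exists (undup (b :: t), fun a => e a + y a); split.
- exact: undup_uniq.
- move=> a /=; apply: hcompD => //; rewrite /e.
  by case: eqP => [->|_] //; apply: hcomp0.
- move=> a; rewrite mem_undup inE negb_or => /andP[/negbTE ab /y0 /= ->].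
  by rewrite /e ab addr0.
rewrite big_cons yE big_split; congr (_ + _).
  rewrite (@big_supp _ _ _ [:: b] e) ?undup_uniq ?big_seq1 /e ?eqxx // => a.
    by rewrite mem_undup inE negb_or => /andP[/negbTE ->].
  by rewrite inE => /negbTE ->.
apply: big_supp => //; first exact: undup_uniq.
by move=> a; rewrite mem_undup inE negb_or => /andP[_ /y0].
Qed.

(* The degree-[a] component of [x] and the finite support of [x]. *)
Definition hsupp (M : persmod) (x : M) : seq deg := (projT1 (cid (hdecomp_ex x))).1.
Definition hpart (M : persmod) (a : deg) (x : M) : M :=
  (projT1 (cid (hdecomp_ex x))).2 a.

Lemma hsupp_uniq (M : persmod) (x : M) : uniq (hsupp x).
Proof. by rewrite /hsupp; case: cid => sy /= []. Qed.

Lemma hpart_hcomp (M : persmod) a (x : M) : hcomp a (hpart a x).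
Proof. by rewrite /hpart; case: cid => sy /= []. Qed.

Lemma hpart_supp (M : persmod) a (x : M) : a \notin hsupp x -> hpart a x = 0.
Proof. by rewrite /hsupp /hpart; case: cid => sy /= [_ _ h _]; apply: h. Qed.

Lemma hpart_sum (M : persmod) (x : M) : x = \sum_(a <- hsupp x) hpart a x.
Proof. by rewrite /hsupp /hpart; case: cid => sy /= []. Qed.

Lemma hpart_unique (M : persmod) (x : M) (s : seq deg) (y : deg -> M) :
  uniq s -> (forall a, hcomp a (y a)) -> (forall a, a \notin s -> y a = 0) ->
  x = \sum_(a <- s) y a -> forall a, hpart a x = y a.
Proof.
move=> us hy y0 xE a; apply/eqP; rewrite -subr_eq0; apply/eqP.
pose t := undup (hsupp x ++ s).
have ts b : b \notin t -> b \notin hsupp x /\ b \notin s.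
  by rewrite mem_undup mem_cat negb_or => /andP.
have [at_|/ts[/hpart_supp -> /y0 ->]] := boolP (a \in t); last by rewrite subrr.
apply: (@hcomp_free M t (fun b => hpart b x - y b)) => //.
- exact: undup_uniq.
- by move=> b; apply: hcompB => //; apply: hpart_hcomp.
rewrite sumrB (@big_supp _ _ t (hsupp x) (fun b => hpart b x)).
- rewrite (@big_supp _ _ t s y) ?undup_uniq // -?hpart_sum -?xE ?subrr //.
  by move=> b /ts[_ /y0].
- exact: undup_uniq.
- exact: hsupp_uniq.
- by move=> b /ts[/hpart_supp].
- by move=> b; apply: hpart_supp.
Qed.

Lemma hpart_id (M : persmod) a b (x : M) :
  hcomp a x -> hpart b x = if b == a then x else 0.
Proof.
move=> hx; apply: (@hpart_unique M x [:: a] (fun b => if b == a then x else 0)) => //.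
- by move=> c; case: eqP => [->|_] //; apply: hcomp0.
- by move=> c; rewrite inE => /negbTE ->.
- by rewrite big_seq1 eqxx.
Qed.

Lemma hpartB (M : persmod) a (x y : M) : hpart a (x - y) = hpart a x - hpart a y.
Proof.
pose t := undup (hsupp x ++ hsupp y).
have ts b : b \notin t -> b \notin hsupp x /\ b \notin hsupp y.
  by rewrite mem_undup mem_cat negb_or => /andP.
apply: (@hpart_unique M _ t (fun b => hpart b x - hpart b y)).
- exact: undup_uniq.
- by move=> b; apply: hcompB; apply: hpart_hcomp.
- by move=> b /ts[/hpart_supp -> /hpart_supp ->]; rewrite subrr.
rewrite sumrB {1}[x]hpart_sum {1}[y]hpart_sum; congr (_ - _).
  apply: big_supp; rewrite ?undup_uniq ?hsupp_uniq //.
    by move=> b; apply: hpart_supp.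
  by move=> b /ts[/hpart_supp].
apply: big_supp; rewrite ?undup_uniq ?hsupp_uniq //.
  by move=> b; apply: hpart_supp.
by move=> b /ts[_ /hpart_supp].
Qed.

Lemma hpart0 (M : persmod) a : hpart a (0 : M) = 0.
Proof. by rewrite -(subrr 0) hpartB !subrr. Qed.

Lemma hpartD (M : persmod) a (x y : M) : hpart a (x + y) = hpart a x + hpart a y.
Proof. by rewrite -[y in LHS]opprK hpartB -[- y]sub0r hpartB hpart0 sub0r opprK. Qed.

Lemma hpart_act (M : persmod) a c (m : 'X_{1..n}) (x : M) :
  hpart a ((c *: 'X_[m]) *: x) = (c *: 'X_[m]) *: hpart (a - mdegZ m) x.
Proof.
apply: (@hpart_unique M _ [seq b + mdegZ m | b <- hsupp x]
  (fun a => (c *: 'X_[m]) *: hpart (a - mdegZ m) x)).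
- by rewrite map_inj_uniq ?hsupp_uniq //; apply: addIr.
- by move=> b; rewrite -{1}[b](subrK (mdegZ m)); apply/hcomp_act/hpart_hcomp.
- move=> b hb; rewrite hpart_supp ?scaler0 //; apply: contra hb => hb.
  by apply/mapP; exists (b - mdegZ m) => //; rewrite subrK.
rewrite big_map {1}[x]hpart_sum scaler_sumr.
by apply: eq_bigr => b _; rewrite addrK.
Qed.

Section TensorPersmod.
Context (M N : persmod).
Implicit Types (x : M) (y : N) (t : tensor M N) (d : deg).

(* The degree-[d] component is spanned by the [x (x) y] with [x], [y]
   homogeneous of degrees summing to [d]. *)
Inductive tensor_hcomp d : tensor M N -> Prop :=
| tensor_hcomp0 : tensor_hcomp d 0
| tensor_hcompB t t' :
    tensor_hcomp d t -> tensor_hcomp d t' -> tensor_hcomp d (t - t')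
| tensor_hcomp_tens a b x y :
    hcomp a x -> hcomp b y -> a + b = d -> tensor_hcomp d (tens x y).

Let part d x y : tensor M N :=
  \sum_(a <- hsupp x) tens (hpart a x) (hpart (d - a) y).

Let tens0l y : tens (0 : M) y = 0.
Proof. by apply: (addrI (tens 0 y)); rewrite -tensDl !addr0. Qed.

Let tens0r x : tens x (0 : N) = 0.
Proof. by apply: (addrI (tens x 0)); rewrite -tensDr !addr0. Qed.

Let partE d x y (s : seq deg) : uniq s ->
  (forall a, a \notin s -> hpart a x = 0) ->
  part d x y = \sum_(a <- s) tens (hpart a x) (hpart (d - a) y).
Proof.
move=> us hs; apply: big_supp => //; first exact: hsupp_uniq.
  by move=> a /hpart_supp ->.
by move=> a /hs ->.
Qed.

Let partDl d x x' y : part d (x + x') y = part d x y + part d x' y.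
Proof.
pose s := undup (hsupp x ++ hsupp x').
have hs a : a \notin s -> hpart a x = 0 /\ hpart a x' = 0.
  rewrite mem_undup mem_cat negb_or => /andP[h h'].
  by rewrite !hpart_supp.
have us : uniq s by apply: undup_uniq.
rewrite !(partE _ _ us); try by move=> a /hs [].
  by rewrite -big_split; apply: eq_bigr => a _; rewrite hpartD tensDl.
by move=> a /hs [h h']; rewrite hpartD h h' addr0.
Qed.

Let partDr d x y y' : part d x (y + y') = part d x y + part d x y'.
Proof.
by rewrite -big_split; apply: eq_bigr => a _; rewrite hpartD tensDr.
Qed.

Let part_bal1 d c m x y :
  part d ((c *: 'X_[m]) *: x) y = part d x ((c *: 'X_[m]) *: y).
Proof.
rewrite (@partE d _ y [seq a + mdegZ m | a <- hsupp x]).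
- rewrite big_map; apply: eq_bigr => a _.
  by rewrite !hpart_act addrK tens_bal opprD addrA.
- by rewrite map_inj_uniq ?hsupp_uniq //; apply: addIr.
- move=> a ha; rewrite hpart_act hpart_supp ?scaler0 //.
  apply: contra ha => ha; apply/mapP; exists (a - mdegZ m) => //.
  by rewrite subrK.
Qed.

Let part_bal d r x y : part d (r *: x) y = part d x (r *: y).
Proof.
rewrite [r]mpolyE !scaler_suml.
elim: (msupp r) => [|m s IH].
  rewrite !big_nil /part [RHS]big1; last by move=> a _; rewrite hpart0 tens0r.
  by rewrite big1 // => a _; rewrite hpart0 tens0l.
by rewrite !big_cons partDl partDr part_bal1 IH.
Qed.

Let proj d t : tensor M N := tensor_lift (part d) t.

Let projB d t t' : proj d (t - t') = proj d t - proj d t'.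
Proof. exact: (tensor_liftB (partDl d) (partDr d) (part_bal d)). Qed.

Let proj0 d : proj d 0 = 0.
Proof. by rewrite -(subrr 0) projB !subrr. Qed.

Let proj_tens d x y : proj d (tens x y) = part d x y.
Proof. exact: (tensor_lift_tens (partDl d) (partDr d) (part_bal d)). Qed.

Let projE d d' t : tensor_hcomp d t -> proj d' t = if d' == d then t else 0.
Proof.
elim=> [|t1 t2 _ IH1 _ IH2|a b x y hx hy ab].
- by rewrite proj0 if_same.
- by rewrite projB IH1 IH2; case: eqP => // _; rewrite subrr.
rewrite proj_tens (@partE d' x y [:: a]) //; last first.
  by move=> c; rewrite inE (hpart_id _ hx) => /negbTE ->.
rewrite big_seq1 (hpart_id _ hx) eqxx (hpart_id _ hy).
have -> : (d' - a == b) = (d' == d) by rewrite subr_eq addrC ab.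
by case: eqP => // _; rewrite tens0r.
Qed.

Fact tensor_gen t : exists2 s : seq (tensor M N),
  (forall u, u \in s -> exists d, tensor_hcomp d u) & t = \sum_(u <- s) u.
Proof.
elim/tensor_ind: t => [|t t' [s hs ->] [s' hs' ->]|x y].
- by exists [::] => //; rewrite big_nil.
- exists (s ++ [seq - u | u <- s']); last by rewrite big_cat big_map sumrN.
  move=> u; rewrite mem_cat => /orP[/hs //|/mapP[v /hs'[d hv] ->]].
  exists d; rewrite -sub0r; apply: tensor_hcompB => //; exact: tensor_hcomp0.
exists [seq tens (hpart a x) (hpart b y) | a <- hsupp x, b <- hsupp y].
  move=> u /allpairsP[[a b] /= [_ _ ->]]; exists (a + b).
  by apply: tensor_hcomp_tens (erefl _); apply: hpart_hcomp.
rewrite big_allpairs_dep /= {1}[x]hpart_sum {1}[y]hpart_sum.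
elim: (hsupp x) => [|a s IH]; first by rewrite !big_nil tens0l.
rewrite !big_cons tensDl IH; congr (_ + _).
elim: (hsupp y) => [|b s' IH']; first by rewrite !big_nil tens0r.
by rewrite !big_cons tensDr IH'.
Qed.

Fact tensor_free (s : seq deg) (u : deg -> tensor M N) : uniq s ->
  (forall d, tensor_hcomp d (u d)) -> \sum_(d <- s) u d = 0 ->
  forall d, d \in s -> u d = 0.
Proof.
move=> us hu sum0 d ds; have := proj0 d; rewrite -sum0.
have -> : proj d (\sum_(d' <- s) u d') = \sum_(d' <- s) proj d (u d').
  elim: (s) => [|a s' IH]; first by rewrite !big_nil proj0.
  rewrite !big_cons -IH -[\sum_(j <- s') u j in LHS]opprK projB.
  by rewrite -[- \sum_(j <- s') u j]sub0r projB proj0 sub0r opprK.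
rewrite (bigD1_seq d) //= big1 ?addr0; last first.
  by move=> d' dd'; rewrite (projE _ (hu d')) eq_sym (negbTE dd').
by rewrite (projE _ (hu d)) eqxx.
Qed.

Fact tensor_act (c : k) m d t :
  tensor_hcomp d t -> tensor_hcomp (d + mdegZ m) ((c *: 'X_[m]) *: t).
Proof.
elim=> [|t1 t2 _ IH1 _ IH2|a b x y hx hy <-].
- rewrite scaler0; exact: tensor_hcomp0.
- rewrite scalerBr; exact: tensor_hcompB.
rewrite scaler_tens; apply: tensor_hcomp_tens (hcomp_act c m hx) hy _.
by rewrite addrAC.
Qed.

Definition tensor_pm : persmod :=
  @PersMod (tensor M N : lmodType R) tensor_hcomp tensor_hcomp0 tensor_hcompB
    tensor_gen tensor_free tensor_act.

End TensorPersmod.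

Section TensorPmor.
Context (F A B : persmod) (f : pmor A B).

Fact tensor_pmor_hcomp a (t : tensor_pm F A) :
  hcomp a t -> hcomp (p := tensor_pm F B) a (@tensor_map R F A B f t).
Proof.
elim=> [|t1 t2 _ IH1 _ IH2|b c x y hx hy bc].
- rewrite raddf0; exact: tensor_hcomp0.
- rewrite raddfB; exact: tensor_hcompB.
by rewrite tensor_mapE; apply: tensor_hcomp_tens bc => //; apply: pmor_hcomp.
Qed.

Definition tensor_pmor : pmor (tensor_pm F A) (tensor_pm F B) :=
  @PMor (tensor_pm F A) (tensor_pm F B) (@tensor_map R F A B f) tensor_pmor_hcomp.

End TensorPmor.

Section GradedHom.
Context (M N : persmod).

Definition ghom_deg (a : deg) (g : M -> N) : Prop :=
  exists h : pmor M (pm_shift N a), g = h.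

(* The sum of the [Nat(M, N(a))] inside the [R]-linear maps [M -> N]; it is
   direct, by [ghom_free]. *)
Definition ghom_pred : {pred M -> N} := fun g =>
  `[< exists2 s : seq (M -> N),
        (forall h, h \in s -> exists a, ghom_deg a h) & g = \sum_(h <- s) h >].

Lemma ghom_degP a g : ghom_deg a g <->
  linear g /\ forall d x, hcomp d x -> hcomp (a + d) (g x).
Proof.
split=> [[h ->]|[lg hg]]; first by split; [exact: linearP|move=> d x hx; exact: (pmor_hcomp h hx)].
pose lin : {linear M -> pm_shift N a} :=
  HB.pack g (GRing.isLinear.Build R M (pm_shift N a) _ g lg).
by exists (@PMor M (pm_shift N a) lin hg).
Qed.

Fact ghom_submod_closed : submod_closed ghom_pred.
Proof.
split; first by apply/asboolP; exists [::] => //; rewrite big_nil.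
move=> r g g' /asboolP[s hs ->] /asboolP[s' hs' ->]; apply/asboolP.
exists ([seq (r@_m *: 'X_[m]) *: h | h <- s, m <- msupp r] ++ s').
  move=> h; rewrite mem_cat => /orP[/allpairsP[[h' m] /= [/hs[a hh'] _ ->]]|/hs' //].
  exists (a + mdegZ m); apply/ghom_degP; case/ghom_degP: hh' => lh hh.
  split=> [c x y|d x hx].
    by rewrite !fctE lh scalerDr !scalerA mulrC.
  by rewrite !fctE addrAC; apply/hcomp_act/hh.
rewrite big_cat /= big_allpairs_dep /=; congr (_ + _).
rewrite scaler_sumr; apply: eq_bigr => h _.
by rewrite [r in LHS]mpolyE scaler_suml.
Qed.

HB.instance Definition _ :=
  GRing.isSubmodClosed.Build R (M -> N) ghom_pred ghom_submod_closed.

Record ghom : Type := GHom { ghom_fun :> M -> N; _ : ghom_fun \in ghom_pred }.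

HB.instance Definition _ := [isSub for ghom_fun].
HB.instance Definition _ := [Choice of ghom by <:].
HB.instance Definition _ := [SubChoice_isSubLmodule of ghom by <:].

Lemma ghomP (g : ghom) : exists2 s : seq (M -> N),
  (forall h, h \in s -> exists a, ghom_deg a h) & g = \sum_(h <- s) h :> (M -> N).
Proof. by case: g => g gP /=; apply/asboolP. Qed.

Lemma ghom_deg_mem a g : ghom_deg a g -> g \in ghom_pred.
Proof.
move=> hg; apply/asboolP; exists [:: g]; last by rewrite big_seq1.
by move=> h; rewrite inE => /eqP ->; exists a.
Qed.

Lemma ghom_linear (g : ghom) : linear g.
Proof.
have [s hs ->] := ghomP g; move=> c x y.
elim: s hs => [|h s IH] hs; first by rewrite !big_nil -[LHS]/(0 : N) -[RHS]/(c *: 0 + 0 : N) scaler0 addr0.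
have [a /ghom_degP[lh _]] := hs h (mem_head _ _).
rewrite !big_cons !fctE lh IH; first by rewrite scalerDr addrACA.
by move=> h' h's; apply: hs; rewrite inE h's orbT.
Qed.

HB.instance Definition _ (g : ghom) :=
  GRing.isLinear.Build R M N _ g (ghom_linear g).

Definition ghom_hcomp (a : deg) (g : ghom) : Prop := ghom_deg a g.

Fact ghom_hcomp0 a : ghom_hcomp a 0.
Proof.
apply/ghom_degP; split=> [c x y|d x _]; first exact: ghom_linear.
exact: (hcomp0 N (a + d)).
Qed.

Fact ghom_hcompB a (g h : ghom) :
  ghom_hcomp a g -> ghom_hcomp a h -> ghom_hcomp a (g - h).
Proof.
move=> /ghom_degP[lg hg] /ghom_degP[lh hh]; apply/ghom_degP.
split=> [|d x hx]; first exact: ghom_linear.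
by apply: hcompB; [exact: hg|exact: hh].
Qed.

Fact ghom_gen (g : ghom) : exists2 s : seq ghom,
  (forall h, h \in s -> exists a, ghom_hcomp a h) & g = \sum_(h <- s) h.
Proof.
have [s hs gE] := ghomP g.
have [s' [hs' ss']] : exists s' : seq ghom,
    (forall h, h \in s' -> exists a, ghom_hcomp a h) /\ s = [seq ghom_fun h | h <- s'].
  elim: s hs {gE} => [|h s IH] hs; first by exists [::].
  have [a ah] := hs h (mem_head _ _).
  have [|s' [hs' ->]] := IH; first by move=> h' h's; apply: hs; rewrite inE h's orbT.
  exists (GHom (ghom_deg_mem ah) :: s'); split => // h'.
  by rewrite inE => /orP[/eqP ->|/hs' //]; exists a.
exists s' => //; apply/val_inj; rewrite /= gE ss' big_map.
exact/esym/(raddf_sum (\val : ghom -> M -> N)).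
Qed.

Fact ghom_free (s : seq deg) (g : deg -> ghom) : uniq s ->
  (forall a, ghom_hcomp a (g a)) -> \sum_(a <- s) g a = 0 ->
  forall a, a \in s -> g a = 0.
Proof.
move=> us hg sum0 a as_; apply/val_inj/funext => x /=.
have sumE z : \sum_(b <- s) g b z = 0.
  rewrite -[RHS]/((0 : ghom) z) -sum0.
  elim: (s) => [|b s' IH]; first by rewrite !big_nil.
  by rewrite !big_cons IH.
have [t ht ->] := hcomp_gen x.
rewrite -[ghom_fun (g a)]/(g a : M -> N) (linear_sum (g a)) big_seq big1 // => z /ht[d hd].
pose y c : N := if c - d \in s then g (c - d) z else 0.
have := @hcomp_free N [seq b + d | b <- s] y _ _ _ (a + d).
rewrite /y addrK as_; apply.
- by rewrite map_inj_uniq //; apply: addIr.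
- move=> c; case: ifP => _; last exact: hcomp0.
  by have /ghom_degP[_ /(_ d z hd)] := hg (c - d); rewrite subrK.
- rewrite big_map -[RHS](sumE z) !big_seq; apply: eq_bigr => b bs.
  by rewrite addrK bs.
- exact: map_f.
Qed.

Fact ghom_act (c : k) m a (g : ghom) :
  ghom_hcomp a g -> ghom_hcomp (a + mdegZ m) ((c *: 'X_[m]) *: g).
Proof.
move=> /ghom_degP[lg hg]; apply/ghom_degP.
split=> [|d x hx]; first exact: ghom_linear.
by rewrite addrAC; apply/hcomp_act/hg.
Qed.

Definition ghom_pm : persmod :=
  @PersMod (ghom : lmodType R) ghom_hcomp ghom_hcomp0 ghom_hcompB
    ghom_gen ghom_free ghom_act.

End GradedHom.

Section GradedHomMap.
Context (A B E : persmod) (f : pmor A B).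

Fact ghom_pre_mem (g : ghom B E) : (g : B -> E) \o f \in @ghom_pred A E.
Proof.
have [s hs gE] := ghomP g; apply/asboolP.
exists [seq h \o f | h <- s].
  move=> h /mapP[h' /hs[a /ghom_degP[lh hh]] ->]; exists a; apply/ghom_degP.
  split=> [c x y|d x hx] /=; first by rewrite linearP lh.
  exact/hh/pmor_hcomp.
rewrite big_map gE; elim: (s) => [|h s' IH]; first by rewrite !big_nil.
by rewrite !big_cons -IH.
Qed.

Definition ghom_pre (g : ghom_pm B E) : ghom_pm A E := GHom (ghom_pre_mem g).

Fact ghom_pre_linear : linear ghom_pre.
Proof. by move=> r g h; apply: val_inj. Qed.

HB.instance Definition _ := GRing.isLinear.Build R (ghom_pm B E) (ghom_pm A E)
  _ ghom_pre ghom_pre_linear.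

Fact ghom_pre_hcomp a (g : ghom_pm B E) : hcomp a g -> hcomp a (ghom_pre g).
Proof.
move=> /ghom_degP[lg hg]; apply/ghom_degP.
split=> [c x y|d x hx] /=; first by rewrite linearP lg.
exact/hg/pmor_hcomp.
Qed.

(* [Hom(f, E)] *)
Definition ghom_pmor : pmor (ghom_pm B E) (ghom_pm A E) :=
  PMor ghom_pre_hcomp.

End GradedHomMap.

Definition short_exact (A B C : persmod) (f : pmor A B) (g : pmor B C) : Prop :=
  [/\ injective f, forall y, g y = 0 <-> exists x, f x = y
    & forall z, exists y, g y = z].

Definition flat (F : persmod) : Prop :=
  forall (A B C : persmod) (f : pmor A B) (g : pmor B C), short_exact f g ->
  short_exact (tensor_pmor F f) (tensor_pmor F g).

Definition ginjective (E : persmod) : Prop :=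
  forall (A B C : persmod) (f : pmor A B) (g : pmor B C), short_exact f g ->
  short_exact (ghom_pmor E g) (ghom_pmor E f).

Definition graded_submod (E : persmod) (S : E -> Prop) : Prop :=
  [/\ S 0, forall (r : R) x y, S x -> S y -> S (r *: x + y)
    & forall x, S x -> exists2 s : seq E,
        (forall y, y \in s -> S y /\ exists a, hcomp a y) & x = \sum_(y <- s) y].

Definition injective_hull (M E : persmod) (g : pmor M E) : Prop :=
  [/\ injective g, ginjective E
    & forall S : E -> Prop, graded_submod S -> (exists2 x, S x & x <> 0) ->
      exists x, S (g x) /\ g x <> 0].

Definition pm_iso (M N : persmod) (h : pmor M N) : Prop :=
  exists h' : pmor N M, cancel h h' /\ cancel h' h.

Definition flat_precover (F M : persmod) (f : pmor F M) : Prop :=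
  flat F /\ forall (F' : persmod) (f' : pmor F' M), flat F' ->
    exists h : pmor F' F, forall x, f (h x) = f' x.

Definition flat_cover (F M : persmod) (f : pmor F M) : Prop :=
  flat_precover f /\
  forall h : pmor F F, (forall x, f (h x) = f x) -> pm_iso h.

(* Pointwise finite-dimensional over [k]: every [M_a] has a finite spanning
   family. *)
Definition pfd (M : persmod) : Prop :=
  forall a, exists2 s : seq M, (forall y, y \in s -> hcomp a y) &
    forall x, hcomp a x -> exists c : nat -> k,
      x = \sum_(i < size s) (c i)%:MP *: s`_i.

(* [k = R / <x_1, ..., x_n>]: the field [k] in degree 0, on which a polynomial
   acts through its constant term. *)
Definition kres : Type := k.
HB.instance Definition _ := GRing.Zmodule.on kres.

Definition kres_scale (r : R) (c : kres) : kres := r@_0%MM * (c : k).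

Fact kres_scaleA r r' c : kres_scale r (kres_scale r' c) = kres_scale (r * r') c.
Proof. by rewrite /kres_scale mulrA rmorphM. Qed.

Fact kres_scale1 : left_id 1 kres_scale.
Proof. by move=> c; rewrite /kres_scale rmorph1 mul1r. Qed.

Fact kres_scaleDr : right_distributive kres_scale +%R.
Proof. by move=> r c c'; rewrite /kres_scale mulrDr. Qed.

Fact kres_scaleDl c : {morph kres_scale^~ c : r r' / r + r'}.
Proof. by move=> r r'; rewrite /kres_scale raddfD mulrDl. Qed.

HB.instance Definition _ := GRing.Zmodule_isLmodule.Build R kres
  kres_scaleA kres_scale1 kres_scaleDr kres_scaleDl.

Definition kres_hcomp (a : deg) (c : kres) : Prop := a = 0 \/ c = 0.

Fact kres_hcomp0 a : kres_hcomp a 0. Proof. by right. Qed.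

Fact kres_hcompB a c c' : kres_hcomp a c -> kres_hcomp a c' -> kres_hcomp a (c - c').
Proof. by case=> [?|->]; case=> [?|->]; rewrite ?subrr; [left|left|left|right]. Qed.

Fact kres_gen (c : kres) : exists2 s : seq kres,
  (forall y, y \in s -> exists a, kres_hcomp a y) & c = \sum_(y <- s) y.
Proof. by exists [:: c]; rewrite ?big_seq1 // => y _; exists 0; left. Qed.

Fact kres_free (s : seq deg) (y : deg -> kres) : uniq s ->
  (forall a, kres_hcomp a (y a)) -> \sum_(a <- s) y a = 0 ->
  forall a, a \in s -> y a = 0.
Proof.
move=> us hy sum0 a as_; have [a0|//] := hy a.
move: sum0; rewrite (bigD1_seq a) //= big1 ?addr0 // => b ba.
by have [b0|//] := hy b; rewrite a0 b0 eqxx in ba.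
Qed.

Fact kres_act (c : k) m a (x : kres) :
  kres_hcomp a x -> kres_hcomp (a + mdegZ m) ((c *: 'X_[m]) *: x).
Proof.
case=> [->|->]; last by right; rewrite scaler0.
have [->|m0] := eqVneq m 0%MM; first by left; rewrite mdegZ0 addr0.
right; rewrite -[LHS]/((c *: 'X_[m])@_0%MM * (x : k)).
by rewrite mcoeffZ mcoeffX (negbTE m0) mulr0 mul0r.
Qed.

Definition kres_pm : persmod :=
  @PersMod (kres : lmodType R) kres_hcomp kres_hcomp0 kres_hcompB
    kres_gen kres_free kres_act.

(* [Ek] is meant to be an injective hull of [kres_pm]; it is a parameter because
   such a hull is only determined up to isomorphism. *)
Definition matlis (Ek M : persmod) : persmod := ghom_pm M Ek.

Definition matlis_mor (Ek M N : persmod) (f : pmor M N) :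
  pmor (matlis Ek N) (matlis Ek M) := ghom_pmor Ek f.

End PersistenceModules.

(* Main.v *)
(* Write D = Hom(-, Ek). As Ek is an injective cogenerator and
   Hom(F (x) -, Ek) = Hom(-, D F), F is flat iff D F is injective. By Baer's
   criterion, Dickson's lemma and the exactness of D, E is injective iff D (D E)
   is, that is, iff D E is flat. If g : M -> E is a hull, the adjunction between
   maps F -> D M and M -> D F makes D g a flat precover. Let h be an endomorphism
   of D E over D M and u = 1 - h, so that u vanishes on M. If x^m e lies in M and
   J kills e, then u phi at e depends only on phi on (0 :_E J + x^m), since
   a phi vanishing there lies in (J + x^m) D E. Noetherian induction on monomial
   ideals J, with Zorn's lemma to glue partial solutions, then shows that
   phi - u phi = psi has exactly one solution, so h is an isomorphism.
   Conversely, if D g is a flat cover and S is a graded submodule of E meeting M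
   trivially, E has an endomorphism over M that kills S; its dual is an
   isomorphism, which forces S = 0. The second part reduces to the first, as
   either condition makes f surjective, so M and F are reflexive. *)

Require Import Defs.
From HB Require Import structures.
From mathcomp Require Import all_boot all_order all_algebra.
From mathcomp Require Import mpoly.
From mathcomp Require Import boolp classical_sets.

Set Implicit Arguments.
Unset Strict Implicit.
Unset Printing Implicit Defensive.

Import GRing.Theory.
Local Open Scope quotient_scope.
Local Open Scope classical_set_scope.
Local Open Scope ring_scope.

(** * Graded submodules, quotients and extension of maps *)

(** Neither [M] nor [E] need be reflexive, so an endomorphism of [D E] over [D M] need not be the
    dual of an endomorphism of [E] over [M], and essentiality of [g] cannot be transported by
    functoriality. It enters through single elements instead: a homogeneous [e <> 0] in [0 :_E J]
    has a nonzero multiple [x^m e] in [M], so [x^m] lies outside [J] and [J + x^m] is strictly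
    larger. Homogeneous ideals are monomial because each degree of [R] has dimension at most one.
    Solving [phi - u phi = psi] cannot proceed one element of [E] at a time, since the value of
    [u phi] at [e] involves [phi] away from [e]. A partial solution is therefore a full element of
    [D E] that satisfies the equation only on [0 :_E J] for the [J] of some set; uniqueness makes
    such solutions agree where both apply, and injectivity of [Ek] extends their union to [E]. *)

Section Basics.
Context (n : nat) (k : fieldType).
Local Notation R := {mpoly k[n]}.
Local Notation deg := 'rV[int]_n.
Implicit Types (M N B X : persmod n k) (a b d : deg) (m : 'X_{1..n}).

Lemma mdegZ_inj : injective (@mdegZ n).
Proof.
move=> m m' /rowP h; apply/mnmP => j.
by have := h j; rewrite !mxE => -[].
Qed.

Lemma mdegZD m m' : mdegZ (m + m')%MM = mdegZ m + mdegZ m'.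
Proof. by apply/rowP=> j; rewrite !mxE mnmDE PoszD. Qed.

Lemma hcompX M m a (x : M) : hcomp a x -> hcomp (a + mdegZ m) (('X_[m] : R) *: x).
Proof. by move=> hx; rewrite -[('X_[m] : R)]scale1r; apply: hcomp_act. Qed.

Lemma hcompC M (c : k) a (x : M) : hcomp a x -> hcomp a ((c%:MP : R) *: x).
Proof.
move=> /(hcomp_act c 0%MM); rewrite mdegZ0 addr0.
by rewrite mpolyX0 alg_mpolyC.
Qed.

Lemma hpartX M m a (x : M) :
  hpart a (('X_[m] : R) *: x) = ('X_[m] : R) *: hpart (a - mdegZ m) x.
Proof. by have := hpart_act a 1 m x; rewrite scale1r. Qed.

Lemma hpart_eq M a (x : M) : hcomp a x -> hpart a x = x.
Proof. by move=> hx; rewrite (hpart_id _ hx) eqxx. Qed.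

Lemma hcomp_deg_inj M a b (x : M) : hcomp a x -> hcomp b x -> x <> 0 -> a = b.
Proof.
move=> ha hb x0; apply: contrapT => /eqP ab; apply: x0.
by rewrite -(hpart_eq ha) (hpart_id _ hb) (negbTE ab).
Qed.

Lemma hpart_sumr M a (I : Type) (s : seq I) (F : I -> M) :
  hpart a (\sum_(i <- s) F i) = \sum_(i <- s) hpart a (F i).
Proof.
elim: s => [|i s IH]; first by rewrite !big_nil hpart0.
by rewrite !big_cons hpartD IH.
Qed.

Lemma ghomD M N (f g : ghom M N) x : (f + g) x = f x + g x.
Proof. by []. Qed.

Lemma ghomB M N (f g : ghom M N) x : (f - g) x = f x - g x.
Proof. by []. Qed.

Lemma ghomZ M N r (f : ghom M N) x : (r *: f) x = r *: f x.
Proof. by []. Qed.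

Lemma ghom_sumE M N (I : Type) (s : seq I) (F : I -> ghom M N) x :
  (\sum_(i <- s) F i) x = \sum_(i <- s) F i x.
Proof.
elim: s => [|i s IH]; first by rewrite !big_nil.
by rewrite !big_cons ghomD IH.
Qed.

Lemma ghom_eq M N (f g : ghom M N) : (forall x, f x = g x) -> f = g.
Proof. by move=> h; apply/val_inj/funext. Qed.

Lemma mk_ghom M N a (g : M -> N) : linear g ->
  (forall d x, hcomp d x -> hcomp (a + d) (g x)) ->
  exists2 f : ghom M N, hcomp (p := ghom_pm M N) a f & forall x, f x = g x.
Proof.
move=> lg hg; have h : ghom_deg a g by apply/ghom_degP.
by exists (GHom (ghom_deg_mem h)).
Qed.

Lemma ghom_apply M N a d (f : ghom M N) x :
  hcomp (p := ghom_pm M N) a f -> hcomp d x -> hcomp (a + d) (f x).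
Proof. by move=> /ghom_degP[_]; apply. Qed.

Lemma ghom_hpart M N a d (f : ghom M N) x :
  hcomp (p := ghom_pm M N) a f -> hpart (a + d) (f x) = f (hpart d x).
Proof.
move=> hf; rewrite (@hpart_unique _ _ _ (f x) [seq a + b | b <- hsupp x]
  (fun b => f (hpart (b - a) x))) ?[a + d]addrC ?addrK //.
- by rewrite map_inj_uniq ?hsupp_uniq //; apply: addrI.
- move=> b; rewrite -[b in hcomp b](subrK a) addrC.
  by apply: ghom_apply => //; apply: hpart_hcomp.
- move=> b hb; rewrite hpart_supp ?linear0 //; apply: contra hb => hb.
  by apply/mapP; exists (b - a) => //; rewrite addrC subrK.
rewrite big_map {1}[x]hpart_sum linear_sum; apply: eq_bigr => b _.
by rewrite [a + b]addrC addrK.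
Qed.

Lemma ghom_hpart' M N a d (f : ghom M N) x :
  hcomp (p := ghom_pm M N) a f -> hpart d (f x) = f (hpart (d - a) x).
Proof. by move=> hf; rewrite -(ghom_hpart _ _ hf) addrC subrK. Qed.

Lemma ghom_hpartl M N d c (f : ghom M N) x : hcomp d x ->
  hpart c (f x) = hpart (M := ghom_pm M N) (c - d) f x.
Proof.
move=> hx; rewrite (@hpart_unique _ _ _ (f x) [seq b + d | b <- hsupp (f : ghom_pm M N)]
  (fun b => hpart (M := ghom_pm M N) (b - d) f x)) //.
- by rewrite map_inj_uniq ?hsupp_uniq //; apply: addIr.
- move=> b; rewrite -[b in hcomp b](subrK d).
  by apply: ghom_apply => //; apply: (hpart_hcomp (M := ghom_pm M N)).
- move=> b hb; rewrite hpart_supp //; apply: contra hb => hb.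
  by apply/mapP; exists (b - d) => //; rewrite subrK.
rewrite big_map {1}[f](hpart_sum (M := ghom_pm M N)) ghom_sumE.
by apply: eq_bigr => b _; rewrite addrK.
Qed.

Lemma pmor_hpart M N (f : pmor M N) a x : hpart a (f x) = f (hpart a x).
Proof.
have [g hg gE] := @mk_ghom M N 0 f (linearP f)
  (fun d x hx => eq_ind_r (fun d' => hcomp d' _) (pmor_hcomp f hx) (add0r d)).
by rewrite -gE (ghom_hpart' _ _ hg) subr0 gE.
Qed.

Lemma mk_pmor M N (g : M -> N) : linear g ->
  (forall d x, hcomp d x -> hcomp d (g x)) ->
  exists f : pmor M N, forall x, f x = g x.
Proof.
move=> lg hg.
pose lin : {linear M -> N} := HB.pack g (GRing.isLinear.Build R M N _ g lg).
by exists (@PMor n k M N lin hg).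
Qed.

Lemma ghom_pmorP M N (g : ghom M N) : hcomp (p := ghom_pm M N) 0 g ->
  exists f : pmor M N, forall x, f x = g x.
Proof.
move=> hg; apply: mk_pmor; first exact: ghom_linear.
by move=> d x hx; rewrite -[d]add0r; apply: ghom_apply.
Qed.

Lemma pmor_ghom M N (f : pmor M N) :
  exists2 g : ghom M N, hcomp (p := ghom_pm M N) 0 g & forall x, g x = f x.
Proof.
apply: mk_ghom; first exact: linearP.
by move=> d x hx; rewrite add0r; apply: pmor_hcomp.
Qed.

Lemma graded_hpart M (S : M -> Prop) : graded_submod S ->
  forall a x, S x -> S (hpart a x).
Proof.
move=> [S0 SP Sg] a x /Sg[s hs ->]; rewrite hpart_sumr.
elim: s hs => [|y s IH] hs; first by rewrite big_nil.
rewrite big_cons -[hpart a y]scale1r; apply: SP; last first.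
  by apply: IH => z zs; apply: hs; rewrite inE zs orbT.
have [Sy [b hb]] := hs y (mem_head _ _).
by rewrite (hpart_id _ hb); case: eqP.
Qed.

Lemma graded_submodI M (S : M -> Prop) : S 0 ->
  (forall (r : R) x y, S x -> S y -> S (r *: x + y)) ->
  (forall a x, S x -> S (hpart a x)) -> graded_submod S.
Proof.
move=> S0 SP Sh; split=> // x Sx; exists [seq hpart a x | a <- hsupp x].
  move=> y /mapP[a _ ->]; split; first exact: Sh.
  by exists a; apply: hpart_hcomp.
by rewrite big_map -hpart_sum.
Qed.

Section Sub.
Context (M : persmod n k) (S : M -> Prop) (HS : graded_submod S).

(* The proof argument lets HB attach the closure properties to [sub_pred HS]. *)
Definition sub_pred of graded_submod S : {pred M} := fun x => `[< S x >].

Fact sub_submod_closed : submod_closed (sub_pred HS).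
Proof.
have [S0 SP _] := HS; split; first exact/asboolP.
by move=> r x y /asboolP hx /asboolP hy; apply/asboolP/SP.
Qed.

HB.instance Definition _ :=
  GRing.isSubmodClosed.Build R M (sub_pred HS) sub_submod_closed.

Record sub_type : Type := SubElt { sub_val :> M; _ : sub_val \in sub_pred HS }.

HB.instance Definition _ := [isSub for sub_val].
HB.instance Definition _ := [Choice of sub_type by <:].
HB.instance Definition _ := [SubChoice_isSubLmodule of sub_type by <:].

Lemma sub_valP (x : sub_type) : S (sub_val x).
Proof. by case: x => y h; apply/asboolP. Qed.

Definition sub_hcomp a (x : sub_type) := hcomp a (sub_val x).

Fact sub_gen (x : sub_type) : exists2 s : seq sub_type,
  (forall y, y \in s -> exists a, sub_hcomp a y) & x = \sum_(y <- s) y.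
Proof.
have hx a : hpart a (sub_val x) \in sub_pred HS.
  exact/asboolP/(graded_hpart HS)/sub_valP.
exists [seq SubElt (hx a) | a <- hsupp (sub_val x)].
  by move=> y /mapP[a _ ->]; exists a; apply: hpart_hcomp.
apply/val_inj; rewrite big_map (raddf_sum (\val : sub_type -> M)) /=.
exact: hpart_sum.
Qed.

Fact sub_free (s : seq deg) (y : deg -> sub_type) : uniq s ->
  (forall a, sub_hcomp a (y a)) -> \sum_(a <- s) y a = 0 ->
  forall a, a \in s -> y a = 0.
Proof.
move=> us hy /(congr1 (\val : sub_type -> M)); rewrite raddf_sum /= => sum0 a as_.
by apply/val_inj/(hcomp_free us hy sum0).
Qed.

Definition sub_pm : persmod n k :=
  @PersMod n k (sub_type : lmodType R) sub_hcomp (fun a => hcomp0 M a)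
    (fun a x y => @hcompB n k M a x y) sub_gen sub_free
    (fun c m a x => @hcomp_act n k M c m a x).

End Sub.

Lemma sub_pm_ex M (S : M -> Prop) : graded_submod S ->
  exists (A : persmod n k) (f : pmor A M),
    injective f /\ forall x, S x <-> exists y, f y = x.
Proof.
move=> HS; exists (sub_pm HS).
have [f fE] : exists f : pmor (sub_pm HS) M, forall x, f x = sub_val x by apply: mk_pmor.
exists f; split=> [x y|x]; first by rewrite !fE => /val_inj.
split=> [Sx|[y <-]]; last by rewrite fE; apply: sub_valP.
have hx : x \in sub_pred HS by apply/asboolP.
by exists (SubElt hx); rewrite fE.
Qed.

Section Quot.
Context (M : persmod n k) (S : M -> Prop) (HS : graded_submod S).

Definition quot_pred of graded_submod S : {pred M} := fun x => `[< S x >].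

Fact quot_zmod_closed : zmod_closed (quot_pred HS).
Proof.
have [S0 SP _] := HS; split; first exact/asboolP.
move=> x y /asboolP hx /asboolP hy; apply/asboolP.
by rewrite addrC -scaleN1r; apply: SP.
Qed.

HB.instance Definition _ := GRing.isZmodClosed.Build M (quot_pred HS) quot_zmod_closed.

Definition quot : Type := Quotient.quot (quot_pred HS).
HB.instance Definition _ := GRing.Zmodule.on quot.

Definition qpi (x : M) : quot := \pi_(Quotient.quot (quot_pred HS)) x.
Definition qrepr (c : quot) : M := repr (c : Quotient.quot (quot_pred HS)).

Lemma qreprK c : qpi (qrepr c) = c. Proof. exact: reprK. Qed.

Lemma qpiD x y : qpi (x + y) = qpi x + qpi y. Proof. exact: raddfD. Qed.

Lemma qpi_eq x y : qpi x = qpi y <-> S (x - y).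
Proof.
split=> [/eqP|h]; first by rewrite -Quotient.idealrBE => /asboolP.
by apply/eqP; rewrite -Quotient.idealrBE; apply/asboolP.
Qed.

Definition qscale (r : R) (c : quot) : quot := qpi (r *: qrepr c).

Lemma qscaleE r x : qscale r (qpi x) = qpi (r *: x).
Proof.
apply/qpi_eq; rewrite -scalerBr -[_ *: _]addr0.
by have [S0 SP _] := HS; apply: SP => //; apply/qpi_eq; rewrite qreprK.
Qed.

Fact qscaleA r r' c : qscale r (qscale r' c) = qscale (r * r') c.
Proof. by rewrite -(qreprK c) !qscaleE scalerA. Qed.
Fact qscale1 : left_id 1 qscale.
Proof. by move=> c; rewrite -(qreprK c) qscaleE scale1r. Qed.
Fact qscaleDr : right_distributive qscale +%R.
Proof. by move=> r c c'; rewrite -(qreprK c) -(qreprK c') -qpiD !qscaleE scalerDr qpiD. Qed.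
Fact qscaleDl c : {morph qscale^~ c : r r' / r + r'}.
Proof. by move=> r r'; rewrite -(qreprK c) !qscaleE scalerDl qpiD. Qed.

HB.instance Definition _ := GRing.Zmodule_isLmodule.Build R quot
  qscaleA qscale1 qscaleDr qscaleDl.

Lemma qpi_linear : linear qpi.
Proof. by move=> r x y; rewrite qpiD -qscaleE. Qed.

HB.instance Definition _ := GRing.isLinear.Build R M quot _ qpi qpi_linear.

Lemma qpi0 x : qpi x = 0 <-> S x.
Proof. by rewrite -(raddf0 qpi) qpi_eq subr0. Qed.

Definition quot_hcomp a (c : quot) := exists2 x, hcomp a x & c = qpi x.

Fact quot_hcomp0 a : quot_hcomp a 0.
Proof. by exists 0; [apply: hcomp0|rewrite raddf0]. Qed.

Fact quot_hcompB a c c' : quot_hcomp a c -> quot_hcomp a c' -> quot_hcomp a (c - c').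
Proof. by move=> [x hx ->] [y hy ->]; exists (x - y); [apply: hcompB|rewrite raddfB]. Qed.

Fact quot_gen (c : quot) : exists2 s : seq quot,
  (forall y, y \in s -> exists a, quot_hcomp a y) & c = \sum_(y <- s) y.
Proof.
exists [seq qpi (hpart a (qrepr c)) | a <- hsupp (qrepr c)].
  by move=> y /mapP[a _ ->]; exists a, (hpart a (qrepr c)) => //; apply: hpart_hcomp.
by rewrite big_map -{1}(qreprK c) {1}[qrepr c]hpart_sum raddf_sum.
Qed.

Fact quot_free (s : seq deg) (y : deg -> quot) : uniq s ->
  (forall a, quot_hcomp a (y a)) -> \sum_(a <- s) y a = 0 ->
  forall a, a \in s -> y a = 0.
Proof.
move=> us hy.
have /choice[x hx] : forall a, exists x, hcomp a x /\ y a = qpi x.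
  by move=> a; have [x] := hy a; exists x.
rewrite (eq_bigr (fun a => qpi (x a))); last by move=> a _; have [_] := hx a.
rewrite -raddf_sum => /qpi0 /(graded_hpart HS) h a as_.
have [_ ->] := hx a; apply/qpi0.
have {h} := h a; rewrite hpart_sumr (bigD1_seq a) //= hpart_eq; last by have [] := hx a.
rewrite big1 ?addr0 // => b ba.
by have [/(hpart_id a) -> _] := hx b; rewrite eq_sym (negbTE ba).
Qed.

Fact quot_act (c : k) m a (x : quot) :
  quot_hcomp a x -> quot_hcomp (a + mdegZ m) ((c *: 'X_[m]) *: x).
Proof.
move=> [y hy ->]; exists ((c *: 'X_[m]) *: y); first exact: hcomp_act.
by rewrite linearZ.
Qed.

Definition quot_pm : persmod n k :=
  @PersMod n k (quot : lmodType R) quot_hcomp quot_hcomp0 quot_hcompB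
    quot_gen quot_free quot_act.

End Quot.

Lemma quot_pm_ex M (S : M -> Prop) : graded_submod S ->
  exists (C : persmod n k) (f : pmor M C),
    (forall z, exists x, f x = z) /\ forall x, S x <-> f x = 0.
Proof.
move=> HS; exists (quot_pm HS).
have [f fE] : exists f : pmor M (quot_pm HS), forall x, f x = qpi HS x.
  by apply: mk_pmor; [exact: qpi_linear|move=> d x hx; exists x].
exists f; split=> [z|x]; first by exists (qrepr z); rewrite fE qreprK.
by rewrite fE; split => /(qpi0 HS).
Qed.

Lemma image_graded M N (f : pmor M N) : graded_submod (fun y => exists x, f x = y).
Proof.
apply: graded_submodI.
- by exists 0; rewrite raddf0.
- by move=> r _ _ [x <-] [y <-]; exists (r *: x + y); rewrite linearP.
- by move=> b _ [x <-]; exists (hpart b x); rewrite -pmor_hpart.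
Qed.

(** Exactness of Hom along the cokernel sequence of [f] yields an extension that may have components
    in other degrees; its degree-[a] component still extends [al]. *)
Lemma ginj_ext X : ginjective X -> forall A B (f : pmor A B), injective f ->
  forall a (al : ghom A X), hcomp (p := ghom_pm A X) a al ->
  exists2 be : ghom B X, hcomp (p := ghom_pm B X) a be & forall x, be (f x) = al x.
Proof.
move=> iX A B f fI a al hal.
have HS : graded_submod (fun y : B => exists x, f x = y).
  exact: image_graded.
have [C [g [gS gK]]] := quot_pm_ex HS.
have [|_ _ /(_ al)[be beE]] := iX A B C f g.
  by split => // y; rewrite gK.
exists (hpart (M := ghom_pm B X) a be); first exact: hpart_hcomp.
move=> x.
have -> : al = ghom_pmor X f (hpart (M := ghom_pm B X) a be).
  by rewrite -pmor_hpart beE hpart_eq.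
by [].
Qed.

(** Injectivity for maps presented by a relation: single-valuedness reduces by linearity to the
    value at 0, and no submodule has to be built where a map is given by a formula such as
    [x^m e -> psi e]. *)
Lemma ext_rel X B a (rho : B -> X -> Prop) : ginjective X ->
  rho 0 0 ->
  (forall (r : R) y y' x x', rho y x -> rho y' x' -> rho (r *: y + y') (r *: x + x')) ->
  (forall d y x, rho y x -> rho (hpart d y) (hpart (a + d) x)) ->
  (forall x, rho 0 x -> x = 0) ->
  exists2 be : ghom B X, hcomp (p := ghom_pm B X) a be &
    forall y x, rho y x -> be y = x.
Proof.
move=> iX r0 rP rh rF.
have rB y y' x x' : rho y x -> rho y' x' -> rho (y - y') (x - x').
  by move=> h h'; rewrite [y - _]addrC -scaleN1r [x - _]addrC -(scaleN1r x'); apply: rP.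
have HS : graded_submod (fun y => exists x, rho y x).
  apply: graded_submodI.
  - by exists 0.
  - by move=> r x y [x' hx] [y' hy]; exists (r *: x' + y'); apply: rP.
  - by move=> d y [x h]; exists (hpart (a + d) x); apply: rh.
have [A [f [fI fS]]] := sub_pm_ex HS.
have /choice[al0 al0P] : forall y, exists x, rho (f y) x.
  by move=> y; apply/fS; exists y.
have al0E y x : rho (f y) x -> al0 y = x.
  move=> h; apply/eqP; rewrite -subr_eq0; apply/eqP/rF.
  by rewrite -(subrr (f y)); apply: rB.
have [|d y hy|al hal alE] := @mk_ghom A X a al0.
- by move=> r x y; apply: al0E; rewrite linearP; apply: rP.
- rewrite (al0E y (hpart (a + d) (al0 y))); first exact: hpart_hcomp.
  by rewrite -[y in f y](hpart_eq hy) -pmor_hpart; apply: rh.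
have [be hbe beE] := ginj_ext iX fI hal.
exists be => // z x h; have [y yb] : exists y, f y = z by apply/fS; exists x.
by rewrite -yb beE alE; apply: al0E; rewrite yb.
Qed.

End Basics.

(** * The regular module and separation by maps to the hull of k *)

Section Regular.
Context (n : nat) (k : fieldType).
Local Notation R := {mpoly k[n]}.
Local Notation deg := 'rV[int]_n.
Implicit Types (M N B X : persmod n k) (a b d : deg) (m : 'X_{1..n}).

Lemma hcomp_sum_in M a (I : eqType) (s : seq I) (F : I -> M) :
  (forall i, i \in s -> hcomp a (F i)) -> hcomp a (\sum_(i <- s) F i).
Proof.
move=> h; rewrite big_seq; elim/big_ind: _ => //; first exact: hcomp0.
exact: hcompD.
Qed.

Definition reg_hcomp a (r : R^o) := forall m, (r : R)@_m != 0 -> mdegZ m = a.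

Fact reg_hcomp0 a : reg_hcomp a 0.
Proof. by move=> m; rewrite mcoeff0 eqxx. Qed.

Fact reg_hcompB a r r' : reg_hcomp a r -> reg_hcomp a r' -> reg_hcomp a (r - r').
Proof.
move=> h h' m; have [r0|/h //] := eqVneq (r : R)@_m 0.
have [r0'|/h' //] := eqVneq (r' : R)@_m 0.
by rewrite mcoeffB r0 r0' subrr eqxx.
Qed.

Fact reg_hcomp_mon (c : k) m : reg_hcomp (mdegZ m) ((c *: 'X_[m]) : R).
Proof.
move=> m'; rewrite mcoeffZ mcoeffX.
by case: (m =P m') => [->|] //; rewrite mulr0 eqxx.
Qed.

Fact reg_gen (r : R^o) : exists2 s : seq R^o,
  (forall y, y \in s -> exists a, reg_hcomp a y) & r = \sum_(y <- s) y.
Proof.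
exists [seq ((r : R)@_m *: 'X_[m] : R^o) | m <- msupp (r : R)].
  by move=> y /mapP[m _ ->]; exists (mdegZ m); apply: reg_hcomp_mon.
by rewrite big_map {1}[r](mpolyE (r : R)).
Qed.

Fact reg_free (s : seq deg) (y : deg -> R^o) : uniq s ->
  (forall a, reg_hcomp a (y a)) -> \sum_(a <- s) y a = 0 ->
  forall a, a \in s -> y a = 0.
Proof.
move=> us hy sum0 a as_; apply/mpolyP => m; rewrite mcoeff0.
have [ma|/eqP ma] := eqVneq (mdegZ m) a; last first.
  by apply: contrapT => /eqP /(hy a).
have := congr1 (mcoeff m) sum0; rewrite mcoeff0 raddf_sum (bigD1_seq a) //=.
rewrite big1 ?addr0 // => b /eqP ba; apply: contrapT => /eqP /(hy b) mb.
by apply: ba; rewrite -ma -mb.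
Qed.

Fact reg_act (c : k) m a (r : R^o) :
  reg_hcomp a r -> reg_hcomp (a + mdegZ m) (((c *: 'X_[m]) : R) *: r).
Proof.
move=> hr m'; rewrite -[_ *: r]/((c *: 'X_[m] : R) * r) -scalerAl mulrC mcoeffZ.
have [->|+ _] := eqVneq ((r : R) * 'X_[m])@_m' 0; first by rewrite mulr0 eqxx.
rewrite -mcoeff_msupp (perm_mem (msuppMX _ _)) => /mapP[m0].
by rewrite mcoeff_msupp => /hr <- ->; rewrite mdegZD addrC.
Qed.

Definition reg_pm : persmod n k :=
  @PersMod n k (R^o : lmodType R) reg_hcomp reg_hcomp0 reg_hcompB
    reg_gen reg_free reg_act.

Lemma reg_hcomp1 : hcomp (p := reg_pm) 0 (1 : R).
Proof.
by move=> m; rewrite mcoeff1; have [->|] := eqVneq m 0%MM; rewrite ?mdegZ0 ?eqxx.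
Qed.

Lemma reg_hpart a (r : R) m :
  (hpart (M := reg_pm) a r : R)@_m = if mdegZ m == a then r@_m else 0.
Proof.
pose s := undup [seq mdegZ m | m <- msupp r].
pose p a : R := \sum_(m <- msupp r | mdegZ m == a) r@_m *: 'X_[m].
have pE b m' : (p b)@_m' = if mdegZ m' == b then r@_m' else 0.
  rewrite raddf_sum /= -big_filter.
  have [mr|mr] := boolP (m' \in [seq m <- msupp r | mdegZ m == b]).
    rewrite (bigD1_seq m') ?filter_uniq ?msupp_uniq //= mcoeffZ mcoeffX eqxx mulr1.
    rewrite big1 ?addr0; first by move: mr; rewrite mem_filter => /andP[->].
    by move=> m2 /negbTE m2m; rewrite mcoeffZ mcoeffX m2m mulr0.
  rewrite big_seq big1.
    move: mr; rewrite mem_filter; case: eqP => //= _.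
    by rewrite mcoeff_msupp negbK => /eqP.
  move=> m2 m2s; rewrite mcoeffZ mcoeffX; case: eqP => [m2m|]; last by rewrite mulr0.
  by move: mr; rewrite -m2m m2s.
rewrite (@hpart_unique n k reg_pm r s p) ?undup_uniq ?pE //.
- by move=> b m'; rewrite pE; have [] := eqVneq (mdegZ m') b; rewrite ?eqxx.
- move=> b bs; apply/mpolyP => m'; rewrite pE mcoeff0; case: eqP => // mb.
  apply/eqP; rewrite mcoeff_eq0; apply: contra bs => h.
  by rewrite mem_undup -mb map_f.
apply/mpolyP => m'; rewrite [RHS](raddf_sum (mcoeff m')) /=.
under eq_bigr do rewrite pE.
have [r0|r0] := eqVneq r@_m' 0; first by rewrite r0 big1 // => b _; rewrite if_same.
have ms : mdegZ m' \in s by rewrite mem_undup map_f // mcoeff_msupp.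
rewrite (bigD1_seq _ ms) ?undup_uniq //= eqxx big1 ?addr0 // => b.
by rewrite eq_sym => /negbTE ->.
Qed.

Lemma mk_orb M d (x : M) : hcomp d x -> exists2 f : ghom reg_pm M,
  hcomp (p := ghom_pm reg_pm M) d f & forall r : R, f r = r *: x.
Proof.
move=> hx; apply: (@mk_ghom n k reg_pm M d (fun r : R => r *: x)).
  by move=> r y z; rewrite scalerDl scalerA.
move=> a r hr; rewrite [r](mpolyE (r : R)) scaler_suml.
apply: hcomp_sum_in => m; rewrite mcoeff_msupp => /hr <-.
exact: hcomp_act.
Qed.

Lemma hpart_scale M d b (r : R) (x : M) : hcomp d x ->
  hpart (d + b) (r *: x) = (hpart (M := reg_pm) b r : R) *: x.
Proof. by case/mk_orb=> f hf fE; rewrite -!fE (ghom_hpart _ _ hf). Qed.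

Lemma reg_hpart_mon m (r : R) : (hpart (M := reg_pm) (mdegZ m) r : R) = r@_m *: 'X_[m].
Proof.
apply/mpolyP => m'; rewrite reg_hpart mcoeffZ mcoeffX (inj_eq (@mdegZ_inj _)) eq_sym.
by case: eqP => [->|]; rewrite ?mulr1 ?mulr0.
Qed.

Lemma scaleCX M (c : k) m (x : M) :
  ((c *: 'X_[m]) : R) *: x = (c%:MP : R) *: (('X_[m] : R) *: x).
Proof. by rewrite scalerA mul_mpolyC. Qed.

Lemma scaleXX M m m' (x : M) :
  ('X_[m] : R) *: (('X_[m'] : R) *: x) = ('X_[m + m'] : R) *: x.
Proof. by rewrite scalerA mpolyXD. Qed.

Lemma scaleCK M (c : k) (x : M) : c != 0 -> ((c^-1)%:MP : R) *: ((c%:MP : R) *: x) = x.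
Proof. by move=> c0; rewrite scalerA -mpolyCM mulVf // mpolyC1 scale1r. Qed.

Lemma hpart_scale_mon M d m (r : R) (x : M) : hcomp d x ->
  hpart (d + mdegZ m) (r *: x) = ((r@_m)%:MP : R) *: (('X_[m] : R) *: x).
Proof. by move=> hx; rewrite hpart_scale // reg_hpart_mon scaleCX. Qed.

Lemma scaler_exp M (r : R) (x : M) :
  r *: x = \sum_(m <- msupp r) ((r@_m)%:MP : R) *: (('X_[m] : R) *: x).
Proof. by rewrite {1}[r]mpolyE scaler_suml; apply: eq_bigr => m _; rewrite scaleCX. Qed.

(** Essentiality applied to the cyclic submodule [R e] gives a nonzero [r *: e] in the image of [g].
    The image is graded, so it also contains a nonzero homogeneous component, which is a scalar
    times some [x^m e]. *)
Lemma hull_ess M E (g : pmor M E) : injective_hull g -> forall d (e : E),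
  hcomp d e -> e <> 0 ->
  exists m x, g x = ('X_[m] : R) *: e /\ ('X_[m] : R) *: e <> 0.
Proof.
move=> [_ _ ess] d e he e0.
have HS : graded_submod (fun y : E => exists r : R, y = r *: e).
  apply: graded_submodI.
  - by exists 0; rewrite scale0r.
  - by move=> r _ _ [r1 ->] [r2 ->]; exists (r * r1 + r2); rewrite scalerDl scalerA.
  - move=> a _ [r ->]; exists (hpart (M := reg_pm) (a - d) r).
    by rewrite -(hpart_scale (a - d) r he) addrC subrK.
have [|x [[r gx] gx0]] := ess _ HS.
  by exists e => //; exists 1; rewrite scale1r.
have [m h] : exists m, ((r@_m)%:MP : R) *: (('X_[m] : R) *: e) <> 0.
  apply: contrapT => h; apply: gx0; rewrite gx scaler_exp big1 // => m _.
  by apply: contrapT => h'; apply: h; exists m.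
exists m, ((((r@_m)^-1)%:MP : R) *: hpart (d + mdegZ m) x).
have rm : r@_m != 0 by apply/eqP => r0; apply: h; rewrite r0 mpolyC0 scale0r.
rewrite linearZ /= -pmor_hpart gx hpart_scale_mon // scaleCK //.
by split => // e1; apply: h; rewrite e1 scaler0.
Qed.

End Regular.

(** * The injective hull of [k] as a cogenerator *)

Section Separation.
Context (n : nat) (k : fieldType).
Local Notation R := {mpoly k[n]}.
Local Notation deg := 'rV[int]_n.
Implicit Types (M N B X : persmod n k) (a b d : deg) (m : 'X_{1..n}).
Context (Ek : persmod n k) (i : pmor (kres_pm n k) Ek) (hEk : injective_hull i).

Lemma hull_ginj : ginjective Ek. Proof. by case: hEk. Qed.

(** On [S + R t0], with [t0] a component of [t] outside [S], send [s + r t0] to the constant term of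
    [r], read in [Ek] through [i], and extend by injectivity. *)
Lemma separation M (S : M -> Prop) t : graded_submod S -> ~ S t ->
  exists a (phi : ghom M Ek), [/\ hcomp (p := ghom_pm M Ek) a phi,
    forall x, S x -> phi x = 0 & phi t <> 0].
Proof.
move=> HS St; have [S0 SP _] := HS.
have [d Sd] : exists d, ~ S (hpart d t).
  apply: contrapT => h; apply: St; rewrite [t]hpart_sum.
  elim/big_ind: _ => // [x y Sx Sy|a _].
    by rewrite -[x]scale1r; apply: SP.
  by apply: contrapT => h'; apply: h; exists a.
pose t0 := hpart d t; have ht0 : hcomp d t0 by apply: hpart_hcomp.
have [orb horb orbE] := mk_orb ht0.
have [|a r hr|al hal alE] := @mk_ghom n k (reg_pm n k) Ek 0
    (fun r : R => i (r@_0%MM : kres k)).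
- by move=> r y z /=; rewrite mcoeffD -linearP /= rmorphM.
- rewrite add0r; have [<-|/eqP a0] := eqVneq (mdegZ (0%MM : 'X_{1..n})) a.
    by apply: pmor_hcomp; left; rewrite mdegZ0.
  have -> : (r : R)@_0%MM = 0 by apply: contrapT => /eqP /(hr _).
  by rewrite raddf0; apply: hcomp0.
(* The degree-[d] component of [r t0] is the constant term of [r] times [t0]; if it lies in [S]
   while [t0] does not, the constant term is zero. *)
have orbS r : S (orb r) -> al r = 0.
  move=> /(graded_hpart HS d); rewrite orbE -[d]addr0 -(mdegZ0 n) hpart_scale_mon //.
  rewrite mpolyX0 scale1r => h; rewrite alE.
  have [->|r0] := eqVneq (r : R)@_0%MM 0; first by rewrite raddf0.
  exfalso; apply: Sd; rewrite -/t0 -(scaleCK t0 r0) -[_ *: _]addr0.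
  exact: SP.
have [||||phi hphi phiE] := @ext_rel n k Ek M (- d)
    (fun y z => exists s r, [/\ S s, y = s + orb r & z = al r]) hull_ginj.
- by exists 0, 0; rewrite !linear0 addr0.
- move=> r _ _ _ _ [s1 [r1 [S1 -> ->]]] [s2 [r2 [S2 -> ->]]].
  exists (r *: s1 + s2), (r *: r1 + r2); split; first exact: SP.
    by rewrite linearP scalerDr addrACA.
  by rewrite linearP.
- move=> b _ _ [s [r [Ss -> ->]]].
  exists (hpart b s), (hpart (M := reg_pm n k) (b - d) r).
  split; first exact: graded_hpart.
    by rewrite hpartD (ghom_hpart' _ _ horb).
  by rewrite (ghom_hpart' _ _ hal) subr0 addrC.
- move=> _ [s [r [Ss sr ->]]]; apply: orbS.
  have -> : orb r = (-1) *: s + 0.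
    by rewrite scaleN1r addr0; apply/eqP; rewrite -addr_eq0 addrC -sr.
  exact: SP.
exists (- d), phi; split => // [x Sx|phi0].
  by rewrite (phiE x 0) //; exists x, 0; rewrite !linear0 addr0.
have := ghom_hpart d t hphi; rewrite phi0 hpart0 (phiE _ (i 1)).
  move/esym; rewrite -[0](raddf0 i); have [+ _ _] := hEk => /[apply].
  by move/eqP; rewrite oner_eq0.
exists 0, 1; split => //; first by rewrite add0r orbE scale1r.
by rewrite alE mcoeff1 eqxx.
Qed.

Lemma separation0 M (t : M) : t <> 0 ->
  exists a (phi : ghom M Ek), hcomp (p := ghom_pm M Ek) a phi /\ phi t <> 0.
Proof.
move=> t0; have [|a [phi [h _ h0]]] := @separation M (fun x => x = 0) t _ t0.
  apply: graded_submodI => // [r x y -> ->|a x ->]; first by rewrite scaler0 addr0.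
  exact: hpart0.
by exists a, phi.
Qed.

End Separation.

(** * Dickson's lemma and Baer's criterion *)

Section Dickson.
Context (n : nat).
Implicit Types (m : 'X_{1..n}) (J : 'X_{1..n} -> Prop).

Lemma nat_mono_subseq (f : nat -> nat) : exists2 g : nat -> nat,
  (forall i j, i < j -> g i < g j)%N & (forall i j, i <= j -> f (g i) <= f (g j))%N.
Proof.
(* [c N] will be a position where [f] is least among all positions from [N] on; following such
   positions one after another gives a nondecreasing subsequence. *)
have /choice[c hc] : forall N, exists i, (N <= i)%N /\ forall j, (N <= j)%N -> (f i <= f j)%N.
  move=> N; pose Q v := `[< exists2 i, (N <= i)%N & f i = v >].
  have exQ : exists v, Q v by exists (f N); apply/asboolP; exists N.
  case: (ex_minnP exQ) => v /asboolP[i Ni <-] min; exists i; split => // j Nj.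
  by apply: min; apply/asboolP; exists j.
pose g := fix g j := if j is j'.+1 then c (g j').+1 else c 0%N.
have gS j : (g j < g j.+1)%N by have [] := hc (g j).+1.
have gmono : {homo g : i j / (i < j)%N >-> (i < j)%N}.
  by apply: homo_ltn => // y x z; apply: ltn_trans.
exists g => // i j; rewrite leq_eqVlt => /orP[/eqP -> //|/gmono gij].
case: i gij => [|i] gij; first by have [_] := hc 0%N; apply.
by have [_] := hc (g i).+1; apply; apply: ltn_trans gij.
Qed.

Lemma mon_mono_subseq (f : nat -> 'X_{1..n}) : exists2 g : nat -> nat,
  (forall i j, i < j -> g i < g j)%N & forall i j, (i <= j)%N -> (f (g i) <= f (g j))%MM.
Proof.
suff /(_ (enum 'I_n))[g gi gc] : forall s : seq 'I_n, exists2 g : nat -> nat,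
    (forall i j, i < j -> g i < g j)%N &
    forall c, c \in s -> forall i j, (i <= j)%N -> (f (g i) c <= f (g j) c)%N.
  exists g => // i j ij; apply/mnm_lepP => c.
  by apply: gc => //; rewrite mem_enum.
elim=> [|c s [g gi gc]]; first by exists id.
have [h hi hc] := nat_mono_subseq (fun i => f (g i) c).
exists (g \o h) => [i j ij|c' + i j ij] /=; first exact/gi/hi.
rewrite inE => /orP[/eqP -> |c's]; first exact: hc.
by apply: gc => //; move: ij; rewrite leq_eqVlt => /orP[/eqP -> //|/hi/ltnW].
Qed.

(** Without a finite basis one can keep choosing an element of [J] that lies above no earlier
    choice, and a nondecreasing subsequence of the choices contradicts this. *)
Lemma dickson J : exists2 L : seq 'X_{1..n}, (forall l, l \in L -> J l) &
  forall m, J m -> exists2 l, l \in L & (l <= m)%MM.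
Proof.
apply: contrapT => noL.
have /choice[nxt hnxt] : forall L : seq 'X_{1..n}, exists m,
    (forall l, l \in L -> J l) -> J m /\ forall l, l \in L -> ~ (l <= m)%MM.
  move=> L; apply: contrapT => h; apply: noL; exists L.
    by move=> l lL; apply: contrapT => Jl; apply: h; exists 0%MM => /(_ l lL).
  move=> m Jm; apply: contrapT => h'; apply: h; exists m => _; split => // l lL lm.
  by apply: h'; exists l.
pose F := fix F j := if j is j'.+1 then nxt (F j') :: F j' else [::].
have FJ j l : l \in F j -> J l.
  elim: j l => // j IH l; rewrite inE => /orP[/eqP ->|/IH //].
  by have [] := hnxt _ IH.
have FF i j : (i < j)%N -> nxt (F i) \in F j.
  elim: j => // j IH; rewrite ltnS leq_eqVlt inE => /orP[/eqP ->|/IH ->].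
    by rewrite eqxx.
  by rewrite orbT.
have [g gi gc] := mon_mono_subseq (fun j => nxt (F j)).
have [_ /(_ _ (FF _ _ (gi 0%N 1%N isT)))] := hnxt _ (FJ (g 1%N)).
by apply; apply: gc.
Qed.

(** The exponent sets of monomial ideals. *)
Definition upclosed J := forall m m', J m -> J (m + m')%MM.

Lemma upclosed_le J m m' : upclosed J -> J m -> (m <= m')%MM -> J m'.
Proof. by move=> uJ Jm /submK <-; rewrite addmC; apply: uJ. Qed.

(** Noetherian induction from larger monomial ideals down to smaller ones: a counterexample would
    start a strictly increasing chain, whose union has a finite basis already contained in one
    member. *)
Lemma dickson_ind (Q : ('X_{1..n} -> Prop) -> Prop) :
  (forall J, upclosed J ->
     (forall J' m, upclosed J' -> (forall m', J m' -> J' m') -> J' m -> ~ J m -> Q J') ->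
     Q J) ->
  forall J, upclosed J -> Q J.
Proof.
move=> step J0 uJ0; apply: contrapT => nQ0.
pose bad J := upclosed J /\ ~ Q J.
have /choice[nxt hnxt] : forall J, exists J', bad J ->
    [/\ bad J', forall m, J m -> J' m & exists2 m, J' m & ~ J m].
  move=> J; have [[uJ nQ]|nb] := pselect (bad J); last by exists J => /nb.
  apply: contrapT => h; apply: nQ; apply: step => // J' m uJ' JJ' J'm Jm.
  apply: contrapT => nQ'; apply: h; exists J' => _; split => //.
  by exists m.
pose F j := iter j nxt J0.
have Fb j : bad (F j) by elim: j => [|j /hnxt[]].
have FS j m : F j m -> F j.+1 m by have [_ h _] := hnxt _ (Fb j); apply: h.
have FM i j m : (i <= j)%N -> F i m -> F j m.
  by move=> /subnKC <-; elim: (j - i)%N => [|l IH]; rewrite ?addn0 ?addnS // => /IH /FS.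
have [L LF LU] := dickson (fun m => exists j, F j m).
have [N hN] : exists N, forall l, l \in L -> F N l.
  elim: L LF {LU} => [|l L IH] LF; first by exists 0%N.
  have [|N hN] := IH; first by move=> l' l'L; apply: LF; rewrite inE l'L orbT.
  have [j hj] := LF l (mem_head _ _).
  exists (maxn j N) => l'; rewrite inE => /orP[/eqP ->|/hN].
    by apply: FM hj; rewrite leq_maxl.
  by apply: FM; rewrite leq_maxr.
have [_ _ [m Fm nFm]] := hnxt _ (Fb N).
apply: nFm; have [|l lL lm] := LU m; first by exists N.+1.
by apply: upclosed_le (hN l lL) lm; have [] := Fb N.
Qed.

End Dickson.

(** * Baer's criterion over monomial ideals *)

Section Baer.
Context (n : nat) (k : fieldType).
Local Notation R := {mpoly k[n]}.
Local Notation deg := 'rV[int]_n.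
Implicit Types (M N B X : persmod n k) (a b d : deg) (m : 'X_{1..n}).

(* Baer's condition for the monomial ideal spanned by [J]: a homomorphism of
   degree [a] from it to [X] is given by the images [al m] of its monomials. *)
Definition baer X := forall a (J : 'X_{1..n} -> Prop) (al : 'X_{1..n} -> X),
  upclosed J ->
  (forall m, J m -> hcomp (a + mdegZ m) (al m)) ->
  (forall m m', J m -> al (m + m')%MM = ('X_[m'] : R) *: al m) ->
  exists2 w : X, hcomp a w & forall m, J m -> ('X_[m] : R) *: w = al m.

Lemma ginj_baer X : ginjective X -> baer X.
Proof.
move=> iX a J al uJ hal alX.
(* The linear extension of [al] to all of [R]. It commutes with multiplication on polynomials
   supported in [J], which is what [AM] claims. *)
pose A (r : R) : X := \sum_(m <- msupp r) ((r@_m)%:MP : R) *: al m.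
have AE r (t : seq 'X_{1..n}) : uniq t -> (forall m, m \notin t -> r@_m = 0) ->
    A r = \sum_(m <- t) ((r@_m)%:MP : R) *: al m.
  move=> ut rt; apply: big_supp => // m; last by move=> /rt ->; rewrite mpolyC0 scale0r.
  by rewrite -mcoeff_eq0 => /eqP ->; rewrite mpolyC0 scale0r.
have AD r r' : A (r + r') = A r + A r'.
  pose t := undup (msupp r ++ msupp r').
  have tt m : m \notin t -> r@_m = 0 /\ r'@_m = 0.
    by rewrite mem_undup mem_cat negb_or -!mcoeff_eq0 => /andP[/eqP ? /eqP ?].
  rewrite !(AE _ t) ?undup_uniq //; try by move=> m /tt[h h']; rewrite ?mcoeffD ?h ?h' ?addr0.
  by rewrite -big_split; apply: eq_bigr => m _; rewrite mcoeffD mpolyCD scalerDl.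
have A0 : A 0 = 0 by rewrite /A msupp0 big_nil.
have Asum (I : Type) (s : seq I) (F : I -> R) : A (\sum_(i <- s) F i) = \sum_(i <- s) A (F i).
  by elim: s => [|i s IH]; rewrite ?big_nil // !big_cons AD IH.
have AX (c : k) m : A (c *: 'X_[m]) = (c%:MP : R) *: al m.
  rewrite (AE _ [:: m]) // ?big_seq1 ?mcoeffZ ?mcoeffX ?eqxx ?mulr1 // => m'.
  by rewrite inE mcoeffZ mcoeffX eq_sym => /negbTE ->; rewrite mulr0.
pose supp (r : R) := forall m, r@_m != 0 -> J m.
have AM r r' : supp r' -> A (r * r') = r *: A r'.
  move=> sr'; rewrite [r in LHS]mpolyE [r' in LHS]mpolyE big_distrlr /= Asum.
  rewrite scaler_exp; apply: eq_bigr => m _; rewrite Asum !scaler_sumr !big_seq.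
  apply: eq_bigr => m'; rewrite mcoeff_msupp => /sr' Jm'.
  have -> : (r@_m *: 'X_[m]) * (r'@_m' *: 'X_[m']) = (r@_m * r'@_m') *: 'X_[m' + m] :> R.
    by rewrite -scalerAl -scalerAr scalerA -mpolyXD addmC.
  rewrite AX alX // mpolyCM !scalerA; congr (_ *: _).
  by rewrite -!mulrA; congr (_ * _); rewrite mulrC.
have [||||w hw wE] := @ext_rel n k X (reg_pm n k) a
    (fun r y => supp r /\ y = A r) iX.
- by split => // m; rewrite mcoeff0 eqxx.
- move=> r r1 r2 _ _ [s1 ->] [s2 ->]; split; last by rewrite AD AM.
  move=> m; rewrite mcoeffD -[r *: r1]/((r : R) * (r1 : R)).
  have [->|+ _] := eqVneq (r * r1 : R)@_m 0; first by rewrite add0r; apply: s2.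
  rewrite -mcoeff_msupp => /msuppM_le /allpairsP[[m1 m2] /= [_ + ->]].
  by rewrite mcoeff_msupp addmC => /s1; apply: uJ.
- move=> d r _ [sr ->]; split.
    by move=> m; rewrite reg_hpart; case: ifP => [_ /sr|]; rewrite ?eqxx.
  rewrite hpart_sumr (AE _ (msupp r)) ?msupp_uniq //; last first.
    by move=> m; rewrite -mcoeff_eq0 reg_hpart => /eqP ->; rewrite if_same.
  rewrite big_seq [RHS]big_seq; apply: eq_bigr => m; rewrite mcoeff_msupp => /sr Jm.
  rewrite reg_hpart (hpart_id _ (hcompC _ (hal _ Jm))) (inj_eq (addrI _)) eq_sym.
  by case: ifP => // _; rewrite mpolyC0 scale0r.
- by move=> _ [_ ->].
exists (w (1 : R)).
  by rewrite -[a]addr0; apply: ghom_apply hw _; apply: reg_hcomp1.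
move=> m Jm; rewrite -linearZ /= -[(_ *: _)]/(('X_[m] : R) * 1) mulr1.
rewrite (wE _ (al m)) //; split; last by rewrite -[('X_[m] : R)]scale1r AX scale1r.
by move=> m'; rewrite mcoeffX; have [<-|] := eqVneq m m'; rewrite ?eqxx.
Qed.

Lemma pmor_surj M N (f : pmor M N) :
  (forall a z, hcomp a z -> exists y, f y = z) -> forall z, exists y, f y = z.
Proof.
move=> h z; have /choice[y hy] : forall a, exists y, f y = hpart a z.
  by move=> a; apply: (h a); apply: hpart_hcomp.
exists (\sum_(a <- hsupp z) y a); rewrite [RHS]hpart_sum raddf_sum.
by apply: eq_bigr => a _; apply: hy.
Qed.

Lemma ginj_of_ext X :
  (forall A B (f : pmor A B), injective f ->
   forall a (al : ghom A X), hcomp (p := ghom_pm A X) a al ->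
   exists be : ghom B X, forall x, be (f x) = al x) -> ginjective X.
Proof.
move=> ext A B C f g [fI fg gS]; split.
- move=> u v /(congr1 (fun h => ghom_fun h)) uv; apply: ghom_eq => z.
  by have [y <-] := gS z; apply: (congr1 (fun h => h y) uv).
- move=> v; split=> [fv|[u <-]]; last first.
    by apply: ghom_eq => x /=; rewrite (_ : g (f x) = 0) ?linear0 //; apply/fg; exists x.
  have /choice[u hu] : forall a, exists u, ghom_pmor X g u = hpart a v.
    move=> a; have hv := hpart_hcomp a v; set va := hpart a v in hv *.
    have va0 y : g y = 0 -> va y = 0.
      move=> /fg[x <-]; have := pmor_hpart (ghom_pmor X f) a v.
      by rewrite fv hpart0 => /(congr1 (fun h => ghom_fun h x)).
    have /choice[s hs] := gS.
    have vs c y : g y = c -> va (s c) = va y.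
      move=> gy; have : va (s c - y) = 0 by apply: va0; rewrite linearB hs gy subrr.
      by rewrite linearB => /eqP; rewrite subr_eq0 => /eqP.
    have [||u hu uE] := @mk_ghom n k C X a (va \o s).
    - by move=> r y z /=; rewrite -linearP; apply: vs; rewrite linearP !hs.
    - move=> d x hx /=; rewrite (vs _ (hpart d (s x))).
        by apply: ghom_apply => //; apply: hpart_hcomp.
      by rewrite -pmor_hpart hs hpart_eq.
    by exists u; apply: ghom_eq => y /=; rewrite uE /= (vs _ y).
  exists (\sum_(a <- hsupp v) u a); rewrite [RHS]hpart_sum raddf_sum.
  by apply: eq_bigr => a _; apply: hu.
apply: pmor_surj => a al /(ext _ _ _ fI)[be beE].
by exists be; apply: ghom_eq.
Qed.

Lemma baer_ginj X : baer X -> ginjective X.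
Proof.
move=> bX; apply: ginj_of_ext => A B f fI a al hal.
pose good (G : set (B * X)) := [/\ forall x, G (f x, al x),
  forall (r : R) y y' x x', G (y, x) -> G (y', x') -> G (r *: y + y', r *: x + x'),
  forall d y x, G (y, x) -> G (hpart d y, hpart (a + d) x)
  & forall x, G (0, x) -> x = 0].
pose G0 : set (B * X) := fun p => exists x, p = (f x, al x).
have good0 : good G0.
  split.
  - by move=> x; exists x.
  - move=> r _ _ _ _ [x [-> ->]] [x' [-> ->]]; exists (r *: x + x').
    by rewrite !linearP.
  - by move=> d _ _ [x [-> ->]]; exists (hpart d x); rewrite pmor_hpart (ghom_hpart _ _ hal).
  - move=> _ [x [fx ->]]; rewrite (_ : x = 0) ?linear0 //.
    by apply: fI; rewrite -fx linear0.
(* Zorn's lemma also asks for the union of the empty chain; adjoining [G0] turns that union into the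
   graph of [al] along [f]. *)
have [|G1 [gG maxG]] := @Zorn_bigcup _ (fun G => good (G `|` G0)).
  move=> F FP Ftot; set U := _ `|` _.
  have UE p q : U p -> U q -> exists G, [/\ good G, G `<=` U, G p & G q].
    have G0U : G0 `<=` U by move=> x h; right.
    have GU G : F G -> G `|` G0 `<=` U.
      by move=> FG x [Gx|]; [left; exists G|right].
    move=> [[G FG Gp]|G0p] [[G' FG' Gq]|G0q].
    - have [GG'|G'G] := Ftot _ _ FG FG'.
        by exists (G' `|` G0); split; [exact: FP|exact: GU|left; exact: GG'|left].
      by exists (G `|` G0); split; [exact: FP|exact: GU|left|left; exact: G'G].
    - by exists (G `|` G0); split; [exact: FP|exact: GU|left|right].
    - by exists (G' `|` G0); split; [exact: FP|exact: GU|right|left].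
    - by exists G0; split.
  split.
  - by move=> x; right; exists x.
  - by move=> r y y' x x' h h'; have [G [[_ gP _ _] GU Gp Gq]] := UE _ _ h h'; apply/GU/gP.
  - by move=> d y x h; have [G [[_ _ gh _] GU Gp _]] := UE _ _ h h; apply/GU/gh.
  - by move=> x h; have [G [[_ _ _ gF] GU Gp _]] := UE _ _ h h; apply: gF.
set G := G1 `|` G0 in gG; have [Gf GP Gh GF] := gG.
have G00 : G (0, 0) by have := Gf 0; rewrite !linear0.
have GC (r : R) y x : G (y, x) -> G (r *: y, r *: x).
  by move=> h; have := GP r _ _ _ _ h G00; rewrite !addr0.
have GD y y' x x' : G (y, x) -> G (y', x') -> G (y + y', x + x').
  by move=> h h'; have := GP 1 _ _ _ _ h h'; rewrite !scale1r.
have GFun y x x' : G (y, x) -> G (y, x') -> x = x'.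
  move=> h h'; apply/eqP; rewrite -subr_eq0 addrC -scaleN1r; apply/eqP/GF.
  by rewrite -(addNr y) -scaleN1r; apply: GP.
have dom_hom d y : hcomp d y -> exists x, G (y, x).
  move=> hy; apply: contrapT => ny.
  (* Exponents of the ideal that multiplies [y] into the domain of [G]. Baer's condition then
     supplies the value [w] for [y]. *)
  pose J m := exists x, G (('X_[m] : R) *: y, x).
  have /choice[be hbe] : forall m, exists x, J m -> G (('X_[m] : R) *: y, x).
    by move=> m; have [[x hx]|nJ] := pselect (J m); [exists x|exists 0].
  have [|||w hw wE] := bX (a + d) J be.
  - move=> m m' [x hx]; exists (('X_[m'] : R) *: x).
    by rewrite addmC -scaleXX; apply: GC.
  - move=> m /hbe h; have hX := hcompX m hy.
    rewrite (_ : be m = hpart (a + d + mdegZ m) (be m)); first exact: hpart_hcomp.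
    by apply: GFun (h) _; rewrite -addrA -{1}(hpart_eq hX); apply: Gh.
  - move=> m m' Jm; have Jmm' : J (m + m')%MM.
      by have [x hx] := Jm; exists (('X_[m'] : R) *: x); rewrite addmC -scaleXX; apply: GC.
    by apply: GFun (hbe _ Jmm') _; rewrite addmC -scaleXX; apply/GC/hbe.
  have GX m : J m -> G (('X_[m] : R) *: y, ('X_[m] : R) *: w).
    by move=> Jm; rewrite wE //; apply: hbe.
  (* A multiple of [y] already in the domain has the value that [w] prescribes; this makes [G']
     below single-valued. *)
  have Gr (r : R) x : G (r *: y, x) -> G (r *: y, r *: w).
    move=> h; rewrite !scaler_exp.
    elim: (msupp r) => [|m s IH]; first by rewrite !big_nil.
    rewrite !big_cons; apply: GD => //.
    have [->|r0] := eqVneq (r@_m) 0; first by rewrite mpolyC0 !scale0r.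
    apply/GC/GX; exists (((r@_m)^-1%:MP : R) *: hpart (a + (d + mdegZ m)) x).
    rewrite -[X in (X, _)](scaleCK _ r0) -(hpart_scale_mon m r hy).
    exact/GC/Gh.
  pose G' : set (B * X) := fun p => exists z x (r : R),
    G (z, x) /\ p = (z + r *: y, x + r *: w).
  have GG' : G `<=` G'.
    by move=> [z x] h; exists z, x, 0; rewrite !scale0r !addr0.
  have Gyw : G' (y, w) by exists 0, 0, 1; rewrite !scale1r !add0r.
  apply: (maxG G').
    split; last by move=> /(_ _ Gyw) h; apply: ny; exists w; left.
    by move=> p G1p; apply: GG'; left.
  rewrite setUidl; last by move=> p G0p; apply: GG'; right.
  split.
  - by move=> x; apply/GG'/Gf.
  - move=> r _ _ _ _ [z1 [x1 [r1 [g1 [-> ->]]]]] [z2 [x2 [r2 [g2 [-> ->]]]]].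
    exists (r *: z1 + z2), (r *: x1 + x2), (r * r1 + r2); split; first exact: GP.
    by congr (_, _); rewrite scalerDr scalerDl -scalerA; apply: addrACA.
  - move=> b _ _ [z [x [r [g [-> ->]]]]].
    exists (hpart b z), (hpart (a + b) x), (hpart (M := reg_pm n k) (b - d) r).
    split; first exact: Gh.
    rewrite !hpartD; congr (_ + _, _ + _).
      by rewrite -(hpart_scale (b - d) r hy) [d + _]addrC subrK.
    by rewrite -(hpart_scale (b - d) r hw) -addrA [d + _]addrC subrK.
  - move=> _ [z [x [r [g [zy ->]]]]].
    have ry : r *: y = (-1) *: z by rewrite scaleN1r; apply/eqP; rewrite -addr_eq0 addrC -zy.
    have g' : G (r *: y, (-1) *: x) by rewrite ry; apply: GC.
    by rewrite -(GFun _ _ _ g' (Gr _ _ g')) scaleN1r subrr.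
have /choice[be hbe] : forall y, exists x, G (y, x).
  move=> y; rewrite [y]hpart_sum.
  elim/big_ind: _ => [|y1 y2 [x1 h1] [x2 h2]|d _]; first by exists 0.
    by exists (x1 + x2); apply: GD.
  by apply: (dom_hom d); apply: hpart_hcomp.
have [||be' hbe' beE] := @mk_ghom n k B X a be.
- by move=> r y z; apply: GFun (hbe _) _; apply: GP.
- move=> d y hy; rewrite (_ : be y = hpart (a + d) (be y)); first exact: hpart_hcomp.
  by apply: GFun (hbe _) _; rewrite -{1}(hpart_eq hy); apply: Gh.
by exists be' => x; rewrite beE; apply: GFun (hbe _) _.
Qed.

End Baer.

(** * Flatness and injectivity of the dual *)

Section Curry.
Context (n : nat) (k : fieldType).
Local Notation R := {mpoly k[n]}.
Local Notation deg := 'rV[int]_n.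
Implicit Types (A B C F M N X : persmod n k) (a b c d : deg) (m : 'X_{1..n}).

Definition graded_bilinear A B X c (f : A -> B -> X) :=
  [/\ forall y, linear (f^~ y), forall x, linear (f x) &
      forall d d' x y, hcomp d x -> hcomp d' y -> hcomp (c + d + d') (f x y)].

Lemma curry A B X c (f : A -> B -> X) : graded_bilinear c f ->
  exists2 g : ghom A (ghom_pm B X), hcomp (p := ghom_pm A (ghom_pm B X)) c g &
    forall x y, (g x : ghom B X) y = f x y.
Proof.
move=> [fl fr fh].
have /choice[g0 g0E] : forall x, exists h : ghom B X, forall y, h y = f x y.
  move=> x.
  (* For an inhomogeneous [x] the map [f x] is only a finite sum of homogeneous ones; it is
     assembled from the components of [x] so as to land in [ghom]. *)
  have /choice[h hE] : forall d, exists h : ghom B X, forall y, h y = f (hpart d x) y.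
    move=> d; have [||h _ hE] := @mk_ghom n k B X (c + d) (f (hpart d x)) => //.
      by move=> d' y hy; apply: fh => //; apply: hpart_hcomp.
    by exists h.
  exists (\sum_(d <- hsupp x) h d) => y; rewrite ghom_sumE.
  have [l lE] : exists l : {linear A -> X}, forall x, l x = f x y.
    pose l : {linear A -> X} := HB.pack (f^~ y) (GRing.isLinear.Build R A X _ (f^~ y) (fl y)).
    by exists l.
  by rewrite -lE {2}[x]hpart_sum linear_sum; apply: eq_bigr => d _; rewrite hE lE.
have [||g hg gE] := @mk_ghom n k A (ghom_pm B X) c g0.
- by move=> r x y; apply: ghom_eq => z; rewrite ghomD ghomZ !g0E fl.
- move=> d x hx; apply/ghom_degP; split; first exact: ghom_linear.
  by move=> d' y hy; rewrite g0E; apply: fh.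
by exists g => // x y; rewrite gE g0E.
Qed.

Lemma tensor_uncurry A B X c (f : A -> B -> X) : graded_bilinear c f ->
  exists2 g : ghom (tensor_pm A B) X, hcomp (p := ghom_pm (tensor_pm A B) X) c g &
    forall x y, g (tens x y) = f x y.
Proof.
move=> [fl fr fh].
have Dl x x' y : f (x + x') y = f x y + f x' y by have := fl y 1 x x'; rewrite /= !scale1r.
have Dr x y y' : f x (y + y') = f x y + f x y' by have := fr x 1 y y'; rewrite !scale1r.
have f0l y : f 0 y = 0 by apply: (addrI (f 0 y)); rewrite -Dl !addr0.
have f0r x : f x 0 = 0 by apply: (addrI (f x 0)); rewrite -Dr !addr0.
have Zl (r : R) x y : f (r *: x) y = r *: f x y.
  by have := fl y r x 0; rewrite /= f0l !addr0.
have Zr (r : R) x y : f x (r *: y) = r *: f x y.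
  by have := fr x r y 0; rewrite /= f0r !addr0.
have bal (r : R) x y : f (r *: x) y = f x (r *: y) by rewrite Zl Zr.
pose T := tensor_lift f.
have TE x y : T (tens x y) = f x y by apply: tensor_lift_tens.
have TB t t' : T (t - t') = T t - T t' by apply: tensor_liftB.
have T0 : T 0 = 0 by have := TB 0 0; rewrite !subrr.
have TD t t' : T (t + t') = T t + T t'.
  by have := TB (t + t') t'; rewrite addrK => ->; rewrite subrK.
have [||g hg gE] := @mk_ghom n k (tensor_pm A B) X c T.
- move=> r t t'; rewrite TD; congr (_ + _).
  elim/tensor_ind: t => [|t1 t2 IH IH'|x y].
  - by rewrite scaler0 T0 scaler0.
  - by rewrite scalerBr !TB IH IH' scalerBr.
  - by rewrite scaler_tens !TE Zl.
- move=> d t; elim=> [|t1 t2 _ IH1 _ IH2|a b x y hx hy <-].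
  - by rewrite T0; apply: hcomp0.
  - by rewrite TB; apply: hcompB.
  - by rewrite TE addrA; apply: fh.
by exists g => // x y; rewrite gE TE.
Qed.

(** The factors are exchanged here and in [ghom_curry_bilinear]: [curry] then sends a map on
    [tensor_pm A B] to one from [B] into [ghom_pm A X], and [tensor_uncurry] brings it back. *)
Lemma ghom_tens_bilinear A B X c (g : ghom (tensor_pm A B) X) :
  hcomp (p := ghom_pm (tensor_pm A B) X) c g ->
  graded_bilinear c (fun y x => g (tens x y)).
Proof.
move=> hg; split.
- by move=> x r y y'; rewrite tensDr -tens_bal -scaler_tens linearP.
- by move=> y r x x'; rewrite tensDl -scaler_tens linearP.
- move=> d d' y x hy hx; rewrite -addrA; apply: ghom_apply hg _.
  by apply: (tensor_hcomp_tens hx hy); rewrite addrC.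
Qed.

Lemma ghom_curry_bilinear A B X c (g : ghom A (ghom_pm B X)) :
  hcomp (p := ghom_pm A (ghom_pm B X)) c g ->
  graded_bilinear c (fun y x => (g x : ghom B X) y).
Proof.
move=> hg; split.
- by move=> x; apply: ghom_linear.
- by move=> y r x x'; rewrite linearP ghomD ghomZ.
- move=> d d' y x hy hx; rewrite addrAC; apply: ghom_apply hy.
  exact: (ghom_apply hg hx).
Qed.

Lemma flat_ginj F X : ginjective X -> flat F -> ginjective (ghom_pm F X).
Proof.
move=> iX fF; apply: ginj_of_ext => A B f fI a al hal.
have HS : graded_submod (fun y : B => exists x, f x = y).
  exact: image_graded.
have [C [g [gS gK]]] := quot_pm_ex HS.
have [|tI _ _] := fF A B C f g.
  by split => // y; rewrite gK.
have [T hT TE] := tensor_uncurry (ghom_curry_bilinear hal).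
have [T' hT' TE'] := ginj_ext iX tI hT.
have [be hbe beE] := curry (ghom_tens_bilinear hT').
exists be => x; apply: ghom_eq => y; rewrite beE.
by have := TE' (tens y x); rewrite TE /= tensor_mapE.
Qed.

Lemma tensor_linear_eq A B X (u v : {linear tensor_pm A B -> X}) :
  (forall x y, u (tens x y) = v (tens x y)) -> forall t, u t = v t.
Proof.
move=> uv; elim/tensor_ind=> [|t t' IH IH'|//]; first by rewrite !raddf0.
by rewrite [LHS](raddfB u) [RHS](raddfB v); congr (_ - _).
Qed.

Lemma tensor_map_surj F A B (g : pmor A B) :
  (forall z, exists y, g y = z) -> forall t, exists u, tensor_pmor F g u = t.
Proof.
move=> gS; elim/tensor_ind=> [|t t' [u <-] [u' <-]|x y].
- by exists 0; rewrite raddf0.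
- by exists (u - u'); rewrite raddfB.
- by have [z <-] := gS y; exists (tens x z); rewrite /= tensor_mapE.
Qed.

End Curry.

(** * Flatness tested on the dual *)

Section Matlis.
Context (n : nat) (k : fieldType).
Local Notation R := {mpoly k[n]}.
Local Notation deg := 'rV[int]_n.
Implicit Types (A B C F M N X : persmod n k) (a b c d : deg) (m : 'X_{1..n}).
Context (Ek : persmod n k) (i : pmor (kres_pm n k) Ek) (hEk : injective_hull i).
Local Notation D M := (ghom_pm M Ek).

(** Exactness is tested by maps to [Ek]: a [phi] detecting a failure becomes a map into [D F], which
    is extended by injectivity. Uncurrying the extension factors [phi] through the next tensor
    product, where the offending element is zero. *)
Lemma ginj_flat F : ginjective (D F) -> flat F.
Proof.
move=> iF A B C f g [fI fg gS].
have gf x : g (f x) = 0 by apply/fg; exists x.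
split; last exact: tensor_map_surj.
- move=> t t' tt'; apply/eqP; rewrite -subr_eq0; apply/eqP.
  have {tt'} : tensor_pmor F f (t - t') = 0 by rewrite linearB /= tt' subrr.
  move: (t - t') => {t t'} t ft0; apply: contrapT => t0.
  have [a [phi [hphi]]] := separation0 hEk t0; apply.
  have [al hal alE] := curry (ghom_tens_bilinear hphi).
  have [be hbe beE] := ginj_ext iF fI hal.
  have [T hT TE] := tensor_uncurry (ghom_curry_bilinear hbe).
  have -> : phi t = T (tensor_pmor F f t).
    apply: (@tensor_linear_eq n k F A Ek phi (T \o tensor_pmor F f)) => x y.
    by rewrite /= tensor_mapE TE beE alE.
  by rewrite ft0 linear0.
- move=> t; split=> [gt0|[u <-]]; last first.
    have -> : tensor_pmor F g (tensor_pmor F f u) = 0; last by [].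
    apply: (@tensor_linear_eq n k F A (tensor_pm F C)
      (tensor_pmor F g \o tensor_pmor F f) \0) => x y.
    rewrite /= !tensor_mapE gf; apply: (addrI (tens x 0)).
    by rewrite -tensDr !addr0.
  pose S (t : tensor_pm F B) := exists u, tensor_pmor F f u = t.
  apply: contrapT => St.
  have HS : graded_submod S.
    exact: image_graded.
  have [a [phi [hphi phiS]]] := separation hEk HS St; apply.
  have [al hal alE] := curry (ghom_tens_bilinear hphi).
  have al0 y : g y = 0 -> al y = 0.
    move=> /fg[x <-]; apply: ghom_eq => z; rewrite alE phiS //.
    by exists (tens z x); rewrite /= tensor_mapE.
  have [||||be hbe beE] := @ext_rel n k (D F) C a
      (fun z l => exists2 y, z = g y & l = al y) iF.
  - by exists 0; rewrite linear0.
  - by move=> r _ _ _ _ [y -> ->] [y' -> ->]; exists (r *: y + y'); rewrite linearP.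
  - move=> d _ _ [y -> ->]; exists (hpart d y); first by rewrite pmor_hpart.
    exact: ghom_hpart hal.
  - by move=> _ [y /esym gy ->]; apply: al0.
  have [T hT TE] := tensor_uncurry (ghom_curry_bilinear hbe).
  have -> : phi t = T (tensor_pmor F g t).
    apply: (@tensor_linear_eq n k F B Ek phi (T \o tensor_pmor F g)) => x y.
    rewrite /= tensor_mapE TE (beE _ (al y)) ?alE //.
    by exists y.
  by rewrite gt0 linear0.
Qed.

Lemma flatP F : flat F <-> ginjective (D F).
Proof. by split; [apply: flat_ginj; apply: hull_ginj hEk|exact: ginj_flat]. Qed.

(** A map into the dual of a free module of rank one is determined by its value at the generator,
    which is a map into [Ek] and therefore extends. These modules serve as test objects for
    precovers. *)
Lemma reg_shift_flat d : flat (pm_shift (reg_pm n k) d).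
Proof.
apply/flatP/ginj_of_ext => A B f fI a al hal.
pose one : pm_shift (reg_pm n k) d := (1 : R).
have h1 : hcomp (- d) one.
  by rewrite /= subrr; apply: reg_hcomp1.
have [||al1 hal1 al1E] := @mk_ghom n k A Ek (a - d)
  (fun x => (al x : ghom _ _) one).
- by move=> r x y; rewrite linearP.
- by move=> b x hx; rewrite addrAC; apply: ghom_apply h1; apply: (ghom_apply hal hx).
have [be1 hbe1 be1E] := ginj_ext (hull_ginj hEk) fI hal1.
have [|be hbe beE] := @curry n k B (pm_shift (reg_pm n k) d) Ek a
  (fun y r => (r : R) *: be1 y).
  split.
  - by move=> r r' y y'; rewrite linearP scalerDr !scalerA mulrC.
  - by move=> y r s s'; rewrite scalerDl scalerA.
  - move=> b b' y r hy hr; rewrite -linearZ.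
    rewrite (_ : a + b + b' = (a - d) + (d + b' + b)); last first.
      by rewrite [d + b']addrC -[b' + d + b]addrA [d + b]addrC addrA [b' + b]addrC
        addrACA addNr addr0 addrA.
    apply: ghom_apply hbe1 _.
    have [orb horb orbE] := mk_orb hy.
    by rewrite -orbE addrC; apply: ghom_apply horb _.
exists be => x; apply: ghom_eq => r; rewrite beE be1E al1E -linearZ.
by congr (_ _); rewrite -[RHS]mulr1.
Qed.

(** A map from a shift of [R] that hits [z] has flat source, hence factors through [f]. *)
Lemma precover_surj F M (f : pmor F M) : flat_precover f -> forall z, exists y, f y = z.
Proof.
move=> [_ fP]; apply: pmor_surj => a z hz.
have [orb horb orbE] := mk_orb hz.
have [||g gE] := @mk_pmor n k (pm_shift (reg_pm n k) (- a)) M orb.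
- by move=> r x y; apply: (ghom_linear orb).
- by move=> d r hr; rewrite -[d](addNKr a); apply: ghom_apply horb _.
have [h hE] := fP _ g (reg_shift_flat _).
by exists (h (1 : R)); rewrite hE gE orbE scale1r.
Qed.

Lemma retract_flat F F' (s : pmor F' F) (r : pmor F F') :
  (forall x, r (s x) = x) -> flat F -> flat F'.
Proof.
move=> rs /flatP iF; apply/flatP/ginj_of_ext => A B f fI a al hal.
have [|al' hal' al'E] := @curry n k A F Ek a (fun x y => (al x : ghom _ _) (r y)).
  have [l1 l2 l3] := ghom_curry_bilinear hal; split.
  - by move=> y; apply: l2.
  - by move=> x c y y' /=; rewrite [r _]linearP; apply: (l1 x).
  - move=> d d' x y hx hy /=; rewrite addrAC; apply: l3 => //.
    exact: pmor_hcomp.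
have [be' hbe' be'E] := ginj_ext iF fI hal'.
have [|be hbe beE] := @curry n k B F' Ek a (fun x y => (be' x : ghom _ _) (s y)).
  have [l1 l2 l3] := ghom_curry_bilinear hbe'; split.
  - by move=> y; apply: l2.
  - by move=> x c y y' /=; rewrite [s _]linearP; apply: (l1 x).
  - move=> d d' x y hx hy /=; rewrite addrAC; apply: l3 => //.
    exact: pmor_hcomp.
by exists be => x; apply: ghom_eq => y; rewrite beE be'E al'E rs.
Qed.

Lemma bij_pm_iso M N (h : pmor M N) : (forall x, h x = 0 -> x = 0) ->
  (forall z, exists y, h y = z) -> pm_iso h.
Proof.
move=> h0 hS; have hI : injective h.
  move=> x y xy; apply/eqP; rewrite -subr_eq0; apply/eqP/h0.
  by rewrite linearB /= xy subrr.
have /choice[s hs] := hS.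
have [||h' h'E] := @mk_pmor n k N M s.
- by move=> r x y; apply: hI; rewrite linearP /= !hs.
- move=> d x hx; rewrite (_ : s x = hpart d (s x)); first exact: hpart_hcomp.
  by apply: hI; rewrite -pmor_hpart hs hpart_eq.
by exists h'; split=> x; rewrite h'E; [apply: hI|]; rewrite hs.
Qed.

Lemma flat_cover_iso F F' M M' (f : pmor F M) (f' : pmor F' M')
    (u : pmor F F') (v : pmor M M') :
  pm_iso u -> pm_iso v -> (forall x, f' (u x) = v (f x)) ->
  flat_cover f -> flat_cover f'.
Proof.
move=> [u' [uK u'K]] [v' [vK v'K]] f'u [[fF fP] fI].
have fu' x : f (u' x) = v' (f' x) by rewrite -{2}[x]u'K f'u vK.
have comp A B C (p : pmor A B) (q : pmor B C) : exists pq : pmor A C, forall x, pq x = q (p x).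
  apply: mk_pmor; first by move=> r x y; rewrite !linearP.
  by move=> d x hx; do 2!apply: pmor_hcomp.
split; first split.
- exact: retract_flat u'K fF.
- move=> G g' fG; have [g gE] := comp _ _ _ g' v'.
  have [h hE] := fP _ g fG; have [h' h'E] := comp _ _ _ h u.
  by exists h' => x; rewrite h'E f'u hE gE v'K.
move=> h hE; have [h1 h1E] := comp _ _ _ u h; have [h2 h2E] := comp _ _ _ h1 u'.
have [|g [gK g'K]] := fI h2.
  by move=> x; rewrite h2E h1E fu' hE f'u vK.
have [g1 g1E] := comp _ _ _ u' g; have [g2 g2E] := comp _ _ _ g1 u.
have h2E' x : h2 (u' x) = u' (h x) by rewrite h2E h1E u'K.
exists g2; split=> x; rewrite g2E g1E.
  by rewrite -h2E' gK u'K.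
have := congr1 u (g'K (u' x)); rewrite u'K => {2}<-.
by rewrite h2E h1E u'K.
Qed.

End Matlis.

(** * Double duals and injectivity *)

Section DoubleDual.
Context (n : nat) (k : fieldType).
Local Notation R := {mpoly k[n]}.
Local Notation deg := 'rV[int]_n.
Implicit Types (A B C E F M N X : persmod n k) (a b c d : deg) (m : 'X_{1..n}).

Lemma mdegZB m m' : (m' <= m)%MM -> mdegZ (m - m')%MM = mdegZ m - mdegZ m'.
Proof. by move=> /submK {2}<-; rewrite mdegZD addrK. Qed.

Lemma scaleX_le M m m' (x : M) : (m <= m')%MM ->
  ('X_[m] : R) *: x = 0 -> ('X_[m'] : R) *: x = 0.
Proof. by move=> /submK <- h; rewrite -scaleXX h scaler0. Qed.

Lemma ghomlZ M N (f : ghom M N) (r : R) (x : M) : f (r *: x) = r *: f x.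
Proof. exact: linearZ. Qed.

Lemma ghomlD M N (f : ghom M N) (x y : M) : f (x + y) = f x + f y.
Proof. exact: linearD. Qed.

Lemma ghoml_sum M N (f : ghom M N) (I : Type) (s : seq I) (F : I -> M) :
  f (\sum_(j <- s) F j) = \sum_(j <- s) f (F j).
Proof. exact: linear_sum. Qed.

(* [0 :_M J] for the ideal spanned by the monomials in [J] *)
Definition mon_ann M (J : 'X_{1..n} -> Prop) (x : M) :=
  forall m, J m -> ('X_[m] : R) *: x = 0.

Lemma mon_ann_graded M J : graded_submod (@mon_ann M J).
Proof.
apply: graded_submodI => [m _|r x y hx hy m Jm|a x hx m Jm]; first by rewrite scaler0.
  by rewrite scalerDr scalerA mulrC -scalerA hx // hy // scaler0 addr0.
by rewrite -[a](addrK (mdegZ m)) -hpartX hx // hpart0.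
Qed.

Lemma ghom_kill_hom M N (S : M -> Prop) (f : ghom M N) : graded_submod S ->
  (forall d x, hcomp d x -> S x -> f x = 0) -> forall x, S x -> f x = 0.
Proof.
move=> HS fS x Sx; rewrite [x]hpart_sum linear_sum big1 // => d _.
by apply: (fS d); [apply: hpart_hcomp|apply: graded_hpart].
Qed.

Lemma ghom_hpart_kill M N (S : M -> Prop) (f : ghom M N) a : graded_submod S ->
  (forall x, S x -> f x = 0) -> forall x, S x -> (hpart (M := ghom_pm M N) a f) x = 0.
Proof.
move=> HS fS; apply: ghom_kill_hom => // d x hx Sx.
by rewrite -[a](addrK d) -(ghom_hpartl _ _ hx) fS // hpart0.
Qed.

(** One monomial is peeled off at a time: [x^(m j) e -> psi e], for [e] killed by the remaining
    monomials, is well defined since [psi] kills what all of them kill. An extension [th] of it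
    leaves [psi - x^(m j) th], which vanishes wherever the remaining monomials do, and induction
    applies. *)
Lemma mon_ann_kill X E (I : eqType) (s : seq I) (m : I -> 'X_{1..n})
    (phi : ghom E X) : ginjective X -> uniq s ->
  (forall e, mon_ann (fun m' => exists2 j, j \in s & m j = m') e -> phi e = 0) ->
  exists th : I -> ghom_pm E X, phi = \sum_(j <- s) ('X_[m j] : R) *: th j.
Proof.
move=> iX us.
pose S (s' : seq I) := @mon_ann E (fun m' => exists2 j, j \in s' & m j = m').
suff hom b (psi : ghom E X) : hcomp (p := ghom_pm E X) b psi ->
    (forall e, S s e -> psi e = 0) ->
    exists th : I -> ghom_pm E X, psi = \sum_(j <- s) ('X_[m j] : R) *: th j.
  move=> phiS; have /choice[th thE] : forall b, exists th : I -> ghom_pm E X,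
      hpart (M := ghom_pm E X) b phi = \sum_(j <- s) ('X_[m j] : R) *: th j.
    move=> b; apply: (hom b); first exact: hpart_hcomp.
    exact: ghom_hpart_kill (mon_ann_graded _ _) phiS.
  exists (fun j => \sum_(b <- hsupp (phi : ghom_pm E X)) th b j).
  rewrite [LHS](hpart_sum (M := ghom_pm E X)) (eq_bigr _ (fun b _ => thE b)) exchange_big.
  by apply: eq_bigr => j _; rewrite scaler_sumr.
elim: s us psi => [_|j s IH /= /andP[js us]] psi hpsi psi0.
  exists (fun=> 0); rewrite big_nil; apply: ghom_eq => e.
  by apply: psi0 => m' [].
have [||||th hth thE] := @ext_rel n k X E (b - mdegZ (m j))
    (fun y z => exists e, [/\ S s e, y = ('X_[m j] : R) *: e & z = psi e]) iX.
- by exists 0; rewrite scaler0 linear0; split => // m' _; rewrite scaler0.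
- move=> r _ _ _ _ [e [Se -> ->]] [e' [Se' -> ->]]; exists (r *: e + e').
  split; [|by rewrite scalerDr !scalerA mulrC|by rewrite linearP].
  by have [_ SP _] := mon_ann_graded E (fun m' => exists2 j, j \in s & m j = m'); apply: SP.
- move=> d _ _ [e [Se -> ->]]; exists (hpart (d - mdegZ (m j)) e).
  rewrite hpartX (ghom_hpart' _ _ hpsi); split => //; last first.
    by congr (psi (hpart _ _)); rewrite -[b - _ + d]addrA addrAC subrr add0r addrC.
  exact: graded_hpart (mon_ann_graded _ _) _ _ Se.
- move=> _ [e [Se /esym je ->]]; apply: psi0 => m' [l].
  by rewrite inE => /orP[/eqP -> <- //|ls <-]; apply: Se; exists l.
have [||th' th'E] := IH us (psi - ('X_[m j] : R) *: th).
- apply: (@hcompB n k (ghom_pm E X)) => //.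
  by rewrite -[b](subrK (mdegZ (m j))); apply: (@hcompX n k (ghom_pm E X)).
- move=> e Se; rewrite ghomB ghomZ -ghomlZ (thE _ (psi e)) ?subrr //.
  by exists e.
exists (fun l => if l == j then th else th' l); rewrite big_cons eqxx.
apply/eqP; rewrite addrC -subr_eq; apply/eqP; rewrite [LHS]th'E.
by apply: eq_big_seq => l ls; case: eqP js => // <-; rewrite ls.
Qed.

(** Baer's condition on the ideal of [x^m] and the [x^l], with [x^m] sent to [e] and multiples of an
    [x^l] to 0. Subtraction of exponents truncates at 0, so the [x^(l - m)] generate the colon ideal
    of the [x^l] by [x^m]; that they kill [e] makes the two prescriptions compatible. *)
Lemma ginj_colon E m (s : seq 'X_{1..n}) d (e : E) : ginjective E -> hcomp d e ->
  (forall l, l \in s -> ('X_[l - m] : R) *: e = 0) ->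
  exists2 e' : E, ('X_[m] : R) *: e' = e & forall l, l \in s -> ('X_[l] : R) *: e' = 0.
Proof.
move=> /ginj_baer bE he es.
pose J m' := (m <= m')%MM \/ exists2 l, l \in s & (l <= m')%MM.
pose al m' : E := if (m <= m')%MM then ('X_[m' - m] : R) *: e else 0.
have leD m1 m2 m3 : (m1 <= m2)%MM -> (m1 <= m2 + m3)%MM.
  by move=> h; apply: lepm_trans h (lem_addr _ _).
have [|||w hw wE] := bE (d - mdegZ m) J al.
- by move=> m1 m2 [h|[l ls h]]; [left|right; exists l => //]; apply: leD.
- move=> m' _; rewrite /al; case: ifP => [h|_]; last exact: hcomp0.
  by rewrite -addrA [- _ + _]addrC -mdegZB //; apply: hcompX.
- move=> m1 m2 Jm1; rewrite /al; have [h|h] := boolP (m <= m1)%MM.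
    by rewrite leD // scaleXX addmBA // addmC.
  case: Jm1 h => [->//|[l ls lm1] _]; rewrite scaler0; case: ifP => // _.
  apply: scaleX_le (es l ls); apply/mnm_lepP => c; rewrite !mnmE leq_sub2r //.
  by rewrite (leq_trans (mnm_lepP lm1 c)) // leq_addr.
exists w.
  rewrite wE; last by left; apply: lepm_refl.
  rewrite /al lepm_refl (_ : (m - m)%MM = 0%MM); first by rewrite mpolyX0 scale1r.
  by apply/mnmP => c; rewrite !mnmE subnn.
move=> l ls; rewrite wE; last by right; exists l => //; apply: lepm_refl.
by rewrite /al; case: ifP => // _; apply: es.
Qed.

Lemma ev_ex M X : exists ev : pmor M (ghom_pm (ghom_pm M X) X),
  forall x (phi : ghom M X), (ev x : ghom (ghom_pm M X) X) phi = phi x.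
Proof.
have [|ev0 hev evE] := @curry n k M (ghom_pm M X) X 0 (fun x phi => (phi : ghom M X) x).
  split=> [phi|x r phi psi //|d d' x phi hx hphi]; first exact: ghom_linear.
  by rewrite add0r addrC; apply: (ghom_apply hphi hx).
have [ev evE'] := ghom_pmorP hev.
by exists ev => x phi; rewrite evE'.
Qed.

(* Trivial relations in the dual of an injective: a syzygy among the [phi j]
   over monomials is removed one monomial at a time, as [phi j] kills
   [x^(m j) (0 : m l, l in s) = (0 : (m l - m j), l in s)]. *)
Lemma dual_syzygy E X (I : eqType) (s : seq I) (m : I -> 'X_{1..n}) (J : 'X_{1..n} -> Prop)
    (al : 'X_{1..n} -> ghom_pm (ghom_pm E X) X) (phi : I -> ghom_pm E X) :
  ginjective X -> ginjective E -> uniq s ->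
  (forall m1 m2, J m1 -> al (m1 + m2)%MM = ('X_[m2] : R) *: al m1) ->
  (forall j, j \in s -> J (m j)) ->
  \sum_(j <- s) ('X_[m j] : R) *: phi j = 0 ->
  \sum_(j <- s) (al (m j) : ghom _ _) (phi j) = 0.
Proof.
move=> iX iE us alX; elim: s us phi => [_|j s IH /= /andP[js us]] phi Js phi0.
  by rewrite big_nil.
have Jj := Js j (mem_head _ _).
have Jl l : l \in s -> J (m l) by move=> ls; apply: Js; rewrite inE ls orbT.
have [|th thE] := @mon_ann_kill X E I s (fun l => (m l - m j)%MM) (phi j) iX us.
  apply: ghom_kill_hom (mon_ann_graded _ _) _ => d e he Se.
  have [l|e' <- e'0] := @ginj_colon E (m j) [seq m l | l <- s] d e iE he.
    by move=> /mapP[l' l's ->]; apply: Se; exists l'.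
  have := congr1 (fun f : ghom_pm E X => (f : ghom E X) e') phi0.
  rewrite big_cons ghomD ghom_sumE big_seq big1 ?addr0; last first.
    by move=> l ls; rewrite ghomZ -ghomlZ /= e'0 ?linear0 // map_f.
  by rewrite ghomZ -ghomlZ.
(* Both sides are the exponent of the least common multiple, so a term [x^(m l - m j) th l] of
   [phi j] can be carried over to [phi l] as [x^(m j - m l) th l]. *)
have lcmC l : (m j + (m l - m j) = m l + (m j - m l))%MM by rewrite -!mlcmE mlcmC.
have swap l : l \in s -> (al (m j) : ghom _ _) (('X_[m l - m j] : R) *: th l) =
    (al (m l) : ghom _ _) (('X_[m j - m l] : R) *: th l).
  by move=> /Jl Jml; rewrite !ghomlZ -!ghomZ -(alX _ _ Jj) -(alX _ _ Jml) lcmC.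
rewrite big_cons thE ghoml_sum (eq_big_seq _ swap) -big_split.
rewrite -[RHS](IH us (fun l => phi l + ('X_[m j - m l] : R) *: th l) Jl).
  by apply: eq_bigr => l _; rewrite ghomlD addrC.
move: phi0; rewrite big_cons thE scaler_sumr -big_split => h; rewrite -[RHS]h.
apply: eq_bigr => l _ /=.
by rewrite scalerDr !scalerA -!mpolyXD lcmC addrC.
Qed.

(** A solution of Baer's problem in the double dual is an extension to [D] of the map that sends a
    sum of [x^m phi], with [m] in [J], to the sum of the values of [al m] at [phi]. [dual_syzygy]
    makes this map well defined, and [X] is injective. *)
Lemma double_dual_ginj E X : ginjective X -> ginjective E ->
  ginjective (ghom_pm (ghom_pm E X) X).
Proof.
move=> iX iE; apply: baer_ginj => a J al uJ hal alX.
pose D := ghom_pm E X.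
have [||||w hw wE] := @ext_rel n k X D a (fun psi z => exists s : seq ('X_{1..n} * D),
    [/\ forall p, p \in s -> J p.1, psi = \sum_(p <- s) ('X_[p.1] : R) *: p.2
      & z = \sum_(p <- s) (al p.1 : ghom _ _) p.2]) iX.
- by exists [::]; rewrite !big_nil.
- move=> r _ _ _ _ [s [Js -> ->]] [s' [Js' -> ->]].
  exists ([seq (p.1, r *: p.2) | p <- s] ++ s'); split.
  + by move=> p; rewrite mem_cat => /orP[/mapP[q /Js h ->]|/Js'].
  + rewrite big_cat big_map scaler_sumr; congr (_ + _); apply: eq_bigr => p _.
    by rewrite /= !scalerA mulrC.
  + rewrite big_cat big_map scaler_sumr; congr (_ + _); apply: eq_bigr => p _.
    by rewrite /= linearZ.
- move=> d _ _ [s [Js -> ->]].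
  exists [seq (p.1, hpart (M := D) (d - mdegZ p.1) p.2) | p <- s]; split.
  + by move=> p /mapP[q /Js h ->].
  + by rewrite big_map hpart_sumr; apply: eq_bigr => p _; rewrite hpartX.
  + rewrite big_map hpart_sumr big_seq [RHS]big_seq; apply: eq_bigr => p /Js Jp /=.
    rewrite (ghom_hpart' _ _ (hal _ Jp)); congr (_ (hpart _ _)).
    by rewrite opprD addrACA subrr add0r.
- move=> _ [s [Js s0 ->]].
  (* [s] may contain repetitions, so the sum is indexed by positions, which form a duplicate-free
     list. *)
  pose p0 : 'X_{1..n} * D := (0%MM, 0).
  rewrite (big_nth p0) /index_iota subn0.
  apply: (@dual_syzygy E X nat _ (fun j => (nth p0 s j).1) J al
    (fun j => (nth p0 s j).2) iX iE (iota_uniq _ _) alX).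
    by move=> j; rewrite mem_iota add0n => js; apply: Js; rewrite mem_nth.
  by move/esym: s0; rewrite (big_nth p0) /index_iota subn0.
exists w => // m Jm; apply: ghom_eq => phi; rewrite ghomZ -ghomlZ.
by apply: wE; exists [:: (m, phi)]; rewrite !big_seq1; split => // p; rewrite inE => /eqP ->.
Qed.

(** * Descent of injectivity from the double dual *)

Section Hull.
Context (Ek : persmod n k) (i : pmor (kres_pm n k) Ek) (hEk : injective_hull i).
Local Notation D M := (ghom_pm M Ek).

(** Purity of [E] in its double dual, for monomial equations. The right-hand side [al l] equals
    [x^l y] for some [y] killed by [L']: otherwise a separating [phi] has [x^l phi] vanishing on
    [0 :_E L'], so [om] kills [x^l phi], although its value there is [phi (al l) <> 0]. Subtracting
    [y] makes the equation for [l] homogeneous, and it joins [L']. *)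
Lemma double_dual_solve E (L L' : seq 'X_{1..n}) a (om : ghom (D E) Ek)
    (al : 'X_{1..n} -> E) : hcomp (p := D (D E)) a om ->
  (forall l, l \in L -> hcomp (a + mdegZ l) (al l)) ->
  (forall l phi, l \in L' -> om (('X_[l] : R) *: (phi : D E)) = 0) ->
  (forall l (phi : D E), l \in L -> om (('X_[l] : R) *: phi) = (phi : ghom E Ek) (al l)) ->
  exists e : E, [/\ hcomp a e, forall l, l \in L' -> ('X_[l] : R) *: e = 0
    & forall l, l \in L -> ('X_[l] : R) *: e = al l].
Proof.
elim: L L' om al => [|l L IH] L' om al hom hal om0 omL.
  by exists 0; split => // [|l _]; [apply: hcomp0|rewrite scaler0].
pose N := @mon_ann E (fun m => m \in undup L').
have HN : graded_submod N by apply: mon_ann_graded.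
have kill (phi : D E) : (forall e, N e -> (phi : ghom E Ek) e = 0) -> om phi = 0.
  move=> phiN; have [|th thE] := @mon_ann_kill Ek E _ (undup L') id phi (hull_ginj hEk)
    (undup_uniq _).
    by move=> e he; apply: phiN => m mL; apply: he; exists m.
  rewrite thE linear_sum big_seq big1 // => m; rewrite mem_undup => mL.
  exact: om0.
have [y0 [Ny0 y0E]] : exists y, N y /\ ('X_[l] : R) *: y = al l.
  apply: contrapT => ny; pose S z := exists y, N y /\ ('X_[l] : R) *: y = z.
  have [N0 NP _] := HN.
  have HS : graded_submod S.
    apply: graded_submodI.
    - by exists 0; rewrite scaler0.
    - move=> r _ _ [y [Ny <-]] [z [Nz <-]]; exists (r *: y + z); split; first exact: NP.
      by rewrite scalerDr !scalerA mulrC.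
    - move=> b _ [y [Ny <-]]; exists (hpart (b - mdegZ l) y).
      by rewrite hpartX; split=> //; apply: (graded_hpart HN).
  have [c [phi [hphi phiS]]] := separation hEk HS ny; apply.
  rewrite -omL ?mem_head // kill // => e Ne.
  by rewrite ghomZ -ghomlZ phiS //; exists e.
have [y hy [Ny yE]] : exists2 y, hcomp a y & N y /\ ('X_[l] : R) *: y = al l.
  exists (hpart a y0); first exact: hpart_hcomp.
  split; first exact: (graded_hpart HN).
  by rewrite -[in LHS](addrK (mdegZ l) a) -hpartX y0E hpart_eq //; apply: hal; rewrite mem_head.
have [ev evE] := ev_ex E Ek.
have [|l1 l1L|m phi|m phi mL|e [he eL' eL]] :=
    IH (l :: L') (om - ev y) (fun m => al m - ('X_[m] : R) *: y).
- by apply: (@hcompB n k (D (D E))) => //; apply: pmor_hcomp.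
- apply: hcompB; first by apply: hal; rewrite inE l1L orbT.
  exact: hcompX.
- rewrite ghomB evE ghomZ -ghomlZ inE => /orP[/eqP ->|mL'].
    by rewrite omL ?mem_head // yE subrr.
  by rewrite om0 // Ny ?mem_undup // linear0 subrr.
- by rewrite ghomB evE omL ?inE ?mL ?orbT // [RHS]linearB ghomZ -ghomlZ.
exists (e + y); split=> [|m mL'|m].
- exact: hcompD.
- by rewrite scalerDr Ny ?mem_undup // eL' ?inE ?mL' ?orbT // addr0.
- rewrite inE scalerDr => /orP[/eqP ->|/eL ->]; last by rewrite subrK.
  by rewrite eL' ?mem_head // add0r.
Qed.

(** Dickson's lemma leaves finitely many equations of Baer's problem, so a solution in the double
    dual descends to [E]. *)
Lemma ginj_of_double_dual E : ginjective (D (D E)) -> ginjective E.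
Proof.
move=> /ginj_baer bD; apply: baer_ginj => a J al uJ hal alX.
have [ev evE] := ev_ex E Ek.
have [m Jm|m m' Jm|om hom omE] := bD a J (fun m => ev (al m)) uJ.
- by apply: pmor_hcomp; apply: hal.
- by rewrite alX // linearZ.
have [L LJ JL] := dickson J.
have [l lL|//|l phi lL|e [he _ eL]] := @double_dual_solve E L [::] a om al hom.
- exact/hal/LJ.
- rewrite ghomlZ -[LHS]/((('X_[l] : R) *: om : ghom (D E) Ek) phi).
  by rewrite omE ?evE //; apply: LJ.
exists e => // m /JL[l lL lm].
by rewrite -(submK lm) -scaleXX eL // addmC alX //; apply: LJ.
Qed.

Lemma ginj_dual_flat E : ginjective E <-> flat (D E).
Proof.
split=> [iE|/(flatP hEk)]; last exact: ginj_of_double_dual.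
by apply/(flatP hEk)/double_dual_ginj => //; apply: hull_ginj hEk.
Qed.

End Hull.
End DoubleDual.

(** * Hulls and covers *)

Section HullCover.
Context (n : nat) (k : fieldType).
Local Notation R := {mpoly k[n]}.
Local Notation deg := 'rV[int]_n.
Context (Ek : persmod n k) (i : pmor (kres_pm n k) Ek) (hEk : injective_hull i).
Local Notation D M := (ghom_pm M Ek).
Implicit Types (A B C E F M N X : persmod n k) (a b c d : deg) (m : 'X_{1..n}).

Lemma pmorZ M N (f : pmor M N) (r : R) x : f (r *: x) = r *: f x.
Proof. exact: linearZ. Qed.

Lemma pmorB M N (f : pmor M N) x y : f (x - y) = f x - f y.
Proof. exact: linearB. Qed.

Lemma pmor_sum M N (f : pmor M N) (I : Type) (s : seq I) (F : I -> M) :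
  f (\sum_(j <- s) F j) = \sum_(j <- s) f (F j).
Proof. exact: linear_sum. Qed.

Lemma dual_hull_precover M E (g : pmor M E) : injective g -> ginjective E ->
  flat_precover (matlis_mor Ek g).
Proof.
move=> gI iE; split; first exact/(ginj_dual_flat hEk).
move=> F f' /(flatP hEk) iF.
have [f'0 hf' f'E] := pmor_ghom f'.
have [al hal alE] := curry (ghom_curry_bilinear hf').
have [be hbe beE] := ginj_ext iF gI hal.
have [h0 hh0 h0E] := curry (ghom_curry_bilinear hbe).
have [h hE] := ghom_pmorP hh0.
exists h => x; apply: ghom_eq => y.
by rewrite /= hE h0E beE alE f'E.
Qed.

(** * The equation [phi - u phi = psi] for a [u] that vanishes on [M] *)

Section Deviation.
Context (M E : persmod n k) (g : pmor M E) (hg : injective_hull g).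
Context (u : pmor (D E) (D E)).
Hypothesis ug : forall (phi : D E) x, (u phi : ghom E Ek) (g x) = 0.

Let mon_ann_repr (L : seq 'X_{1..n}) (phi : D E) :
  (forall e, mon_ann (fun m => m \in L) e -> (phi : ghom E Ek) e = 0) ->
  exists th : 'X_{1..n} -> D E, phi = \sum_(l <- undup L) ('X_[l] : R) *: th l.
Proof.
move=> phiL; apply: (@mon_ann_kill n k Ek E _ (undup L) id) => //.
- exact: hull_ginj hEk.
- exact: undup_uniq.
by move=> e he; apply: phiL => m mL; apply: he; exists m => //; rewrite mem_undup.
Qed.

Let u_repr (s : seq 'X_{1..n}) (th : 'X_{1..n} -> D E) e :
  (u (\sum_(l <- s) ('X_[l] : R) *: th l) : ghom E Ek) e =
  \sum_(l <- s) (u (th l) : ghom E Ek) (('X_[l] : R) *: e).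
Proof.
rewrite pmor_sum ghom_sumE; apply: eq_bigr => l _.
by rewrite pmorZ ghomlZ.
Qed.

Let mon_ann_finite (J : 'X_{1..n} -> Prop) : exists2 L : seq 'X_{1..n},
  (forall l, l \in L -> J l) & forall e : E, mon_ann (fun m => m \in L) e -> mon_ann J e.
Proof.
have [L LJ JL] := dickson J; exists L => // e he m /JL[l lL lm].
exact: scaleX_le lm (he l lL).
Qed.

(** The hypothesis puts [phi] in [J (D E)], which every [R]-linear endomorphism preserves. *)
Lemma dual_endo_stable J (phi : D E) :
  (forall e, mon_ann J e -> (phi : ghom E Ek) e = 0) ->
  forall e, mon_ann J e -> (u phi : ghom E Ek) e = 0.
Proof.
move=> phiJ e he; have [L LJ LE] := mon_ann_finite J.
have [|th ->] := @mon_ann_repr L phi; first by move=> e' /LE; apply: phiJ.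
rewrite u_repr big_seq big1 // => l; rewrite mem_undup => /LJ lJ.
by rewrite he // linear0.
Qed.

(* Since [u] vanishes on [M], the values of [u phi] on [0 : J] only depend on
   those of [phi] on [0 : J + x^m], where [x^m e] lies in [M]. *)
Lemma deviation_step J d (e : E) : hcomp d e -> mon_ann J e -> e <> 0 ->
  exists m, [/\ ~ J m, upclosed J -> upclosed (fun m' => J m' \/ (m <= m')%MM) &
    forall phi : D E,
      (forall e', mon_ann (fun m' => J m' \/ (m <= m')%MM) e' -> (phi : ghom E Ek) e' = 0) ->
      (u phi : ghom E Ek) e = 0].
Proof.
move=> he Je e0; have [m [x [gx xe0]]] := hull_ess hg he e0.
exists m; split.
- by move=> /Je.
- move=> uJ m1 m2 [/uJ|mm1]; first by left.
  by right; apply: lepm_trans mm1 (lem_addr _ _).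
move=> phi phi0; have [L LJ LE] := mon_ann_finite J.
have [|th ->] := @mon_ann_repr (m :: L) phi.
  move=> e' he'; apply: phi0 => m' [/(LE e') -> //|].
    by move=> l lL; apply: he'; rewrite inE lL orbT.
  by move=> mm'; apply: scaleX_le mm' _; apply: he'; rewrite mem_head.
rewrite u_repr big_seq big1 // => l; rewrite mem_undup inE => /orP[/eqP ->|/LJ lJ].
  by rewrite -gx ug.
by rewrite Je // linear0.
Qed.

(** By induction [phi] vanishes on [0 :_E (J + x^m)] for the [m] attached to [e], and that already
    forces [u phi], hence [phi], to vanish at [e]. *)
Lemma deviation_uniq J : upclosed J -> forall phi : D E,
  (forall e, mon_ann J e -> (phi : ghom E Ek) e = (u phi : ghom E Ek) e) ->
  forall e, mon_ann J e -> (phi : ghom E Ek) e = 0.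
Proof.
move: J; apply: dickson_ind => J uJ IH phi phiu.
apply: ghom_kill_hom (mon_ann_graded _ _) _ => d e he Je.
have [->|e0] := pselect (e = 0); first by rewrite linear0.
have [m [nJ uJ2 step]] := deviation_step he Je e0.
rewrite phiu //; apply: step; apply: (IH _ m) => //.
- exact: uJ2.
- by left.
- by right; apply: lepm_refl.
by move=> e' he'; apply: phiu => m' Jm'; apply: he'; left.
Qed.

Lemma deviation_solve a (psi : D E) : hcomp a psi -> exists phi : D E, phi - u phi = psi.
Proof.
move=> hpsi.
pose sol (G : set ('X_{1..n} -> Prop)) (phi : D E) := forall J, G J -> upclosed J ->
  forall e, mon_ann J e -> (phi : ghom E Ek) e = (psi : ghom E Ek) e + (u phi : ghom E Ek) e.
pose P G := exists2 phi : D E, hcomp a phi & sol G phi.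
have solP G phi phi' J : sol G phi -> sol G phi' -> G J -> upclosed J ->
    forall e, mon_ann J e -> (phi - phi' : ghom E Ek) e = 0.
  move=> sp sp' GJ uJ; apply: deviation_uniq => // e Je.
  by rewrite pmorB !ghomB (sp J) // (sp' J) // opprD addrACA subrr add0r.
have [|G [[phi hphi sphi] maxG]] := @Zorn_bigcup _ P.
  move=> F FP Ftot; have [[G1 FG1]|nF] := pselect (exists G, F G); last first.
    by exists psi => // J [G FG]; case: nF; exists G.
  (* [K G] stands in for the sum of the [0 :_E J] with [J] in [G]. Described by the maps of degree
     [a] that vanish on all of them, it is closed under combinations at once, and two solutions for
     [G] agree on it. *)
  pose K (G : set ('X_{1..n} -> Prop)) (e : E) := forall phi : D E, hcomp a phi ->
    (forall J, G J -> upclosed J -> forall e', mon_ann J e' -> (phi : ghom E Ek) e' = 0) ->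
    (phi : ghom E Ek) e = 0.
  have KS G G' e : G `<=` G' -> K G e -> K G' e.
    by move=> GG' Ke phi hphi phi0; apply: Ke => // J /GG'; apply: phi0.
  have KE G phi phi' e : hcomp a phi -> hcomp a phi' -> sol G phi -> sol G phi' -> K G e ->
      (phi : ghom E Ek) e = (phi' : ghom E Ek) e.
    move=> hp hp' sp sp' Ke; apply/eqP; rewrite -subr_eq0; apply/eqP.
    apply: (Ke (phi - phi')); first exact: hcompB.
    by move=> J GJ uJ; apply: solP GJ uJ.
  have solS G G' phi : G `<=` G' -> sol G' phi -> sol G phi.
    by move=> GG' sp J /GG'; apply: sp.
  pose rho e z := exists G phi, [/\ F G, hcomp a phi, sol G phi, K G e
    & z = (phi : ghom E Ek) e].
  have [||||Phi hPhi PhiE] := @ext_rel n k Ek E a rho (hull_ginj hEk).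
  - have [phi hp sp] := FP _ FG1; exists G1, phi; split => //; last by rewrite linear0.
    by move=> phi' _ _; rewrite linear0.
  - move=> r e1 e2 _ _ [G [p [FG hp sp Ke ->]]] [G' [p' [FG' hp' sp' Ke' ->]]].
    have KP G'' x y : K G'' x -> K G'' y -> K G'' (r *: x + y).
      move=> Kx Ky q hq q0; rewrite linearP /= (Kx q) // (Ky q) //.
      by rewrite scaler0 addr0.
    have [GG'|G'G] := Ftot _ _ FG FG'.
      exists G', p'; split => //; first by apply: KP => //; apply: KS Ke.
      by rewrite linearP /= (KE G p p') //; apply: solS sp'.
    exists G, p; split => //; first by apply: KP => //; apply: KS Ke'.
    by rewrite linearP /= (KE G' p' p) //; apply: solS sp.
  - move=> d e _ [G [p [FG hp sp Ke ->]]]; exists G, p; split => //.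
      by move=> q hq q0; rewrite -(ghom_hpart _ _ hq) (Ke q) // hpart0.
    exact: ghom_hpart hp.
  - by move=> _ [G [p [_ _ _ _ ->]]]; rewrite linear0.
  exists Phi => // J [G FG GJ] uJ e Je; have [phi hp sp] := FP _ FG.
  have Phiphi e' : mon_ann J e' -> Phi e' = (phi : ghom E Ek) e'.
    by move=> Je'; apply: PhiE; exists G, phi; split => // q _ q0; apply: (q0 J).
  rewrite Phiphi // (sp J) //; congr (_ + _); apply/eqP; rewrite eq_sym -subr_eq0.
  rewrite -[_ - _]/((u Phi - u phi : ghom E Ek) e) -pmorB; apply/eqP.
  apply: (dual_endo_stable (J := J)) => // e' Je'.
  by rewrite ghomB Phiphi // subrr.
have Gall J : upclosed J -> G J.
  move: J; apply: dickson_ind => J uJ IH; apply: contrapT => nGJ.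
  apply: (maxG (G `|` [set J])%classic).
    split; first by move=> J' ?; left.
    by move=> /(_ J) h; apply: nGJ; apply: h; right.
  have phiE J' : G J' -> upclosed J' -> forall e, mon_ann J' e ->
      ((psi + u phi) - phi : ghom E Ek) e = 0.
    by move=> GJ' uJ' e Je; rewrite ghomB ghomD -(sphi J') // subrr.
  (* One further step of the iteration [phi -> psi + u phi] keeps the equation for the members of
     [G] and gains it for [J], as all larger ideals are in [G] already. *)
  exists (psi + u phi); first by apply: hcompD => //; apply: pmor_hcomp.
  move=> J' GJ' uJ' e Je; rewrite ghomD; congr (_ + _).
  apply/eqP; rewrite eq_sym -subr_eq0.
  rewrite -[_ - _]/((u (psi + u phi) - u phi : ghom E Ek) e) -pmorB; apply/eqP.
  case: GJ' => [GJ'|J'J]; first exact: (dual_endo_stable (phiE _ GJ' uJ')).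
  move: e Je; rewrite J'J {J' J'J uJ'}.
  apply: ghom_kill_hom (mon_ann_graded _ _) _ => d e he Je.
  have [->|e0] := pselect (e = 0); first by rewrite linear0.
  have [m [nJ uJ2 step]] := deviation_step he Je e0.
  apply: step; apply: phiE; last exact: uJ2.
  apply: (IH _ m) => //; first exact: uJ2; first by left.
  by right; apply: lepm_refl.
(* The empty set of exponents is the zero ideal, which annihilates all of [E]. *)
exists phi; apply: ghom_eq => e; rewrite ghomB (sphi (fun _ => False)) ?addrK //.
by apply: Gall.
Qed.

End Deviation.

Lemma hull_dual_cover M E (g : pmor M E) : injective_hull g -> flat_cover (matlis_mor Ek g).
Proof.
move=> hg; have [gI iE _] := hg; split; first exact: dual_hull_precover.
move=> h hE.
have [||u uE] := @mk_pmor n k (D E) (D E) (fun phi => phi - h phi).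
- by move=> r x y; rewrite linearP scalerBr opprD addrACA.
- by move=> d x hx; apply: hcompB => //; apply: pmor_hcomp.
have ug (phi : D E) x : (u phi : ghom E Ek) (g x) = 0.
  have := congr1 (fun f : D M => (f : ghom M Ek) x) (hE phi).
  by rewrite /= uE ghomB => ->; rewrite subrr.
have hu phi : h phi = phi - u phi by rewrite uE opprB addrC subrK.
apply: bij_pm_iso.
- move=> phi /eqP; rewrite hu subr_eq0 => /eqP phiu; apply: ghom_eq => e.
  by apply: (deviation_uniq hg ug (J := fun _ => False)) => // e' _; rewrite -phiu.
- apply: pmor_surj => a psi hpsi.
  have [phi phiE] := deviation_solve hg ug hpsi.
  by exists phi; rewrite hu.
Qed.

Lemma inj_of_surj_dual M N (f : pmor M N) :
  (forall psi, exists phi, matlis_mor Ek f phi = psi) -> injective f.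
Proof.
move=> fS x y fxy; apply/eqP; rewrite -subr_eq0; apply/eqP.
apply: contrapT => xy0.
have [a [psi [_ +]]] := separation0 hEk xy0; apply.
have [phi <-] := fS psi.
by rewrite /= (_ : f (x - y) = 0) ?linear0 // linearB /= fxy subrr.
Qed.

Lemma surj_of_inj_dual M N (f : pmor M N) : injective (matlis_mor Ek f) ->
  forall z, exists y, f y = z.
Proof.
move=> fI z; apply: contrapT => nz.
have HS : graded_submod (fun z => exists y, f y = z).
  exact: image_graded.
have [a [phi [_ phi0 +]]] := separation hEk HS nz; apply.
have -> : phi = 0 :> D N; last by [].
by apply: fI; apply: ghom_eq => x; rewrite /= phi0 //; exists x.
Qed.

Lemma cover_dual_hull M E (g : pmor M E) : flat_cover (matlis_mor Ek g) -> injective_hull g.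
Proof.
move=> [gP giso]; have gI : injective g.
  by apply: inj_of_surj_dual; apply: precover_surj hEk _ _ _ gP.
have iE : ginjective E by apply/(ginj_dual_flat hEk); case: gP.
split => // S HS [x0 Sx0 x00]; apply: contrapT => nS.
have [S0 SP _] := HS.
have Sg x : S (g x) -> g x = 0.
  by move=> Sx; apply: contrapT => gx0; apply: nS; exists x.
(* The projection of [g M + S] onto [g M] along [S], well defined since the two meet only in 0,
   extended to an endomorphism of [E]. *)
have [||||t0 ht0 t0E] := @ext_rel n k E E 0
    (fun y z => exists x s, [/\ S s, y = g x + s & z = g x]) iE.
- by exists 0, 0; rewrite raddf0 addr0.
- move=> r _ _ _ _ [x [s [Ss -> ->]]] [x' [s' [Ss' -> ->]]].
  exists (r *: x + x'), (r *: s + s'); split; [exact: SP| |by rewrite linearP].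
  by rewrite linearP /= scalerDr addrACA.
- move=> d _ _ [x [s [Ss -> ->]]]; exists (hpart d x), (hpart d s).
  by rewrite add0r hpartD !pmor_hpart; split => //; apply: (graded_hpart HS).
- move=> _ [x [s [Ss gs ->]]]; apply: Sg.
  have -> : g x = (-1) *: s + 0.
    by rewrite scaleN1r addr0; apply/eqP; rewrite -addr_eq0 -gs.
  exact: SP.
have [t tE] := ghom_pmorP ht0.
have tg x : t (g x) = g x by rewrite tE; apply: t0E; exists x, 0; rewrite addr0.
have tS s : S s -> t s = 0.
  by move=> Ss; rewrite tE; apply: t0E; exists 0, s; rewrite raddf0 add0r.
have [|h' [_ h'K]] := giso (matlis_mor Ek t).
  by move=> phi; apply: ghom_eq => x; rewrite /= tg.
have [a [phi [_ +]]] := separation0 hEk x00; apply.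
(* Since [D t] has the inverse [h'], [phi] is [h' phi] composed with [t], hence zero on [S]. *)
have /(congr1 (fun f : D E => (f : ghom E Ek) x0)) <- := h'K phi.
by rewrite /= tS // linear0.
Qed.

(** * Reflexivity of pointwise finite-dimensional modules *)

Lemma hull_deg0 (y : Ek) : hcomp 0 y -> exists c : k, y = i (c : kres k).
Proof.
move=> hy; have [->|y0] := pselect (y = 0); first by exists 0; rewrite raddf0.
have [m [x [ix ny]]] := hull_ess hEk hy y0.
have hx : hcomp 0 (i x) by apply: pmor_hcomp; left.
have m0 : mdegZ m = mdegZ 0%MM.
  rewrite mdegZ0 -[LHS]add0r; apply: hcomp_deg_inj (hcompX m hy) _ ny.
  by rewrite -ix.
by exists x; rewrite ix (mdegZ_inj m0) mpolyX0 scale1r.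
Qed.

(** A nonzero value of [chi] has a nonzero monomial multiple in the image of [i], so in degree 0,
    and that multiple is a value of [chi] on degree [- c]. This is the injective half of the
    identification of [(D B)_c] with the linear dual of [B_(- c)]. *)
Lemma dual_deg_eq0 B c (chi : ghom B Ek) : hcomp (p := D B) c chi ->
  (forall z, hcomp (- c) z -> chi z = 0) -> forall z, chi z = 0.
Proof.
move=> hchi chi0 z; rewrite [z]hpart_sum ghoml_sum big1 // => d _.
have := hpart_hcomp d z; move: (hpart d z) => {}z hz.
apply: contrapT => cz; have hcz := ghom_apply hchi hz.
have [m [x [ix ny]]] := hull_ess hEk hcz cz.
have hx : hcomp 0 (i x) by apply: pmor_hcomp; left.
have cdm : c + (d + mdegZ m) = 0.
  by rewrite addrA; apply: hcomp_deg_inj (hcompX m hcz) _ ny; rewrite -ix.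
apply: ny; rewrite -ghomlZ; apply: chi0.
rewrite (_ : - c = d + mdegZ m); first exact: hcompX.
by apply/eqP; rewrite eq_sym -addr_eq0 addrC cdm.
Qed.

(** Linear algebra over [k]: a functional vanishing on the common zeros of finitely many evaluations
    is a combination of them. The values count as scalars because degree 0 of [Ek] is the image of
    [k]. *)
Lemma double_dual_point M a (s : seq M) (om : ghom (D M) Ek) :
  hcomp (p := D (D M)) a om -> (forall y, y \in s -> hcomp a y) ->
  (forall th : D M, hcomp (- a) th ->
     (forall y, y \in s -> (th : ghom M Ek) y = 0) -> om th = 0) ->
  exists2 y : M, hcomp a y &
    forall th : D M, hcomp (- a) th -> om th = (th : ghom M Ek) y.
Proof.
have [ev evE] := ev_ex M Ek.
elim: s om => [|y s IH] om hom hs om0.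
  by exists 0; [apply: hcomp0|move=> th hth; rewrite linear0 om0].
have hy := hs y (mem_head _ _).
have {}hs z : z \in s -> hcomp a z by move=> zs; apply: hs; rewrite inE zs orbT.
have deg0 (th : D M) z : hcomp (- a) th -> hcomp a z -> exists c : k,
    (th : ghom M Ek) z = i (c : kres k).
  by move=> hth hz; apply: hull_deg0; rewrite -(addNr a); apply: ghom_apply hth hz.
have iC (c c' : k) : ((c%:MP : R) *: i (c' : kres k)) = i ((c * c') : kres k).
  by rewrite -linearZ; congr (i _); rewrite /GRing.scale /= /kres_scale mcoeffC eqxx mulr1.
have [[th0 [hth0 th0s th0y]]|noth] := pselect (exists th : D M,
    [/\ hcomp (- a) th, forall z, z \in s -> (th : ghom M Ek) z = 0
      & (th : ghom M Ek) y <> 0]); last first.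
  apply: IH => // th hth ths; apply: om0 => // z.
  rewrite inE => /orP[/eqP ->|]; last exact: ths.
  by apply: contrapT => thy; apply: noth; exists th.
have [c cE] := deg0 _ _ hth0 hy.
have c0 : c != 0 by apply/eqP => c0; apply: th0y; rewrite cE c0 raddf0.
have [c' c'E] : exists c' : k, om th0 = i (c' : kres k).
  by apply: hull_deg0; rewrite -(subrr a); apply: ghom_apply hom hth0.
(* The factor [c' / c] makes the corrected functional vanish at [th0]. For [th] vanishing on [s],
   the difference [th - (d / c) th0] vanishes at [y] too, so [om] kills it. *)
have [|//|th hth ths|y' hy' y'E] := IH (om - ev (((c' / c)%:MP : R) *: y)).
- apply: (@hcompB n k (D (D M))) => //; apply: pmor_hcomp; exact: hcompC.
- have [d dE] := deg0 _ _ hth hy.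
  have := om0 (th - ((d / c)%:MP : R) *: th0).
  have -> : om (th - ((d / c)%:MP : R) *: th0) = om th - ((d / c)%:MP : R) *: om th0.
    by rewrite linearB -ghomlZ.
  rewrite ghomB evE ghomlZ dE c'E !iC => h.
  rewrite [c' / c * d]mulrAC [c' * d]mulrC mulrAC.
  apply: h.
    by apply: hcompB => //; apply: hcompC.
  move=> z; rewrite inE => /orP[/eqP ->|zs].
    by rewrite ghomB ghomZ dE cE iC divfK // subrr.
  by rewrite ghomB ghomZ ths // th0s // scaler0 subrr.
exists (y' + ((c' / c)%:MP : R) *: y); first by apply: hcompD => //; apply: hcompC.
by move=> th hth; rewrite ghomlD -y'E // ghomB evE subrK.
Qed.

Lemma pfd_reflexive M : pfd M -> exists2 ev : pmor M (D (D M)), pm_iso ev &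
  forall x (phi : ghom M Ek), (ev x : ghom (D M) Ek) phi = phi x.
Proof.
move=> pM; have [ev evE] := ev_ex M Ek; exists ev => //.
apply: bij_pm_iso => [x evx|].
  apply: contrapT => /(separation0 hEk)[a [phi [_ +]]]; apply.
  by rewrite -evE evx.
apply: pmor_surj => a om hom; have [s hs sP] := pM a.
have [|y hy yE] := double_dual_point hom hs.
  (* A [th] of degree [- a] that vanishes on a spanning family of [M_a] is zero, so the condition on
     [om] is automatic. *)
  move=> th hth ths; rewrite (_ : th = 0) ?linear0 //; apply: ghom_eq.
  apply: (dual_deg_eq0 hth) => z; rewrite opprK => /sP[c ->].
  rewrite ghoml_sum big1 // => j _; rewrite ghomlZ ths ?scaler0 //.
  exact: mem_nth.
exists y; apply/esym/eqP; rewrite -subr_eq0; apply/eqP/ghom_eq.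
apply: (@dual_deg_eq0 (D M) a); first by apply: hcompB => //; apply: pmor_hcomp.
by move=> th hth; rewrite ghomB evE yE // subrr.
Qed.

Lemma pfd_surj F M (f : pmor F M) : (forall z, exists y, f y = z) -> pfd F -> pfd M.
Proof.
move=> fS pF a; have [s hs sP] := pF a.
exists [seq f y | y <- s] => [y /mapP[x /hs hx ->]|x hx]; first exact: pmor_hcomp.
have [y yx] := fS x; have [c cE] := sP _ (hpart_hcomp a y).
exists c; rewrite -(hpart_eq hx) -yx pmor_hpart cE pmor_sum size_map.
by apply: eq_bigr => j _; rewrite pmorZ (nth_map 0).
Qed.

Lemma pfd_cover_dual_hull M F (f : pmor F M) : pfd F ->
  flat_cover f <-> injective_hull (matlis_mor Ek f).
Proof.
move=> pF.
(* With both modules reflexive, naturality of evaluation identifies [f] with its double dual. *)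
have iso : pfd M -> flat_cover f <-> flat_cover (matlis_mor Ek (matlis_mor Ek f)).
  move=> pM; have [evF isoF evFE] := pfd_reflexive pF.
  have [evM isoM evME] := pfd_reflexive pM.
  have sq x : matlis_mor Ek (matlis_mor Ek f) (evF x) = evM (f x).
    by apply: ghom_eq => phi; rewrite evME /= evFE.
  split; first exact: (flat_cover_iso hEk isoF isoM sq).
  have [vF [vFK KvF]] := isoF; have [vM [vMK KvM]] := isoM.
  apply: (@flat_cover_iso n k Ek i hEk _ _ _ _ _ _ vF vM); first by exists evF.
    by exists evM.
  by move=> x; rewrite -{2}[x]KvF sq vMK.
split=> [cf|hf].
  have pM := pfd_surj (precover_surj hEk cf.1) pF.
  by apply: cover_dual_hull; apply/(iso pM).
have [fI _ _] := hf; have pM := pfd_surj (surj_of_inj_dual fI) pF.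
by apply/(iso pM); apply: hull_dual_cover.
Qed.

End HullCover.

Theorem theorem3p2p2 (n : nat) (k : fieldType)
    (Ek : persmod n k) (i : pmor (kres_pm n k) Ek) (hEk : injective_hull i) :
  (forall (M E : persmod n k) (g : pmor M E),
     injective_hull g <-> flat_cover (matlis_mor Ek g)) /\
  (forall (M F : persmod n k) (f : pmor F M), pfd F ->
     (flat_cover f <-> injective_hull (matlis_mor Ek f))).
Proof.
split=> [M E g|M F f]; last exact: pfd_cover_dual_hull hEk _ _ _.
split; [exact: hull_dual_cover hEk _ _ _|exact: cover_dual_hull hEk _ _ _].
Qed.
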